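(* Let $F$ be a field and let $A$ be a monomial $\mathbb{P}^1$ over $F$, i.e. a prime monomial algebra with Hilbert series $H_A(t)=\frac{1}{(1-t)^2}$. Then $\mathcal P(A)$ is a union of a projective line with a Cantor set, with exactly two intersection points; that is, $\varprojlim\mathcal P(A)=L\cup\mathcal C$, where $L$ is a projective line (isomorphic to $\mathbb P^1$), $\mathcal C$ (with the topology induced from the inverse limit) is homeomorphic to the Cantor set, and $|L\cap\mathcal C|=2$. In particular, all monomial $\mathbb P^1$'s over $F$ have isomorphic proalgebraic varieties of point modules: if $A,B$ are monomial $\mathbb P^1$'s then $\mathcal P(A)\cong\mathcal P(B)$.
   Context: A monomial algebra is a quotient $A=F\langle x_1,\dots,x_m\rangle/I$ of a free associative algebra by a proper ideal generated by monomials, graded by $\deg x_i=1$, presented with no $x_i\in I$; its Hilbert series is $\sum_n(\dim_F A_n)t^n$. (For Hilbert series $(1-t)^{-2}$ one has two generators.) A point module is a graded cyclic right $A$-module $P=\bigoplus_{n\ge0}P_n$ generated in degree $0$ with all $\dim_F P_n=1$. Writing $P_i=Fe_i$ and $e_i\cdot x_j=\lambda_{i,j}e_{i+1}$, the isomorphism class of $P$ is recorded by the point $(\underline\lambda_0,\underline\lambda_1,\dots)\in\mathbb P^{m-1}\times\mathbb P^{m-1}\times\cdots$, $\underline\lambda_i=[\lambda_{i,1}:\cdots:\lambda_{i,m}]$. The set of all such points is denoted $\varprojlim\mathcal P(A)$; $\mathcal P_n(A)\subseteq(\mathbb P^{m-1})^{\times(n+1)}$ is its image under projection to the first $n+1$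 factors (a projective variety), $\pi_n\colon\mathcal P_{n+1}(A)\to\mathcal P_n(A)$ is the natural projection, and $\mathcal P(A)=\{(\mathcal P_n(A),\pi_n)\}_{n\ge0}$ is the proalgebraic variety of point modules. The topology on $\varprojlim\mathcal P(A)$ is the inverse limit of the Zariski topologies. A proalgebraic variety is a sequence $\mathcal V=\{(V_n,\varphi_n)\}_{n\ge 0}$ of algebraic varieties and surjective morphisms $\varphi_n\colon V_{n+1}\to V_n$; write $\varphi^{i'}_i\colon V_{i'}\to V_i$ ($i\le i'$) for the composite (identity if $i=i'$). Its points are compatible sequences $(a_n)_n$, $a_n\in V_n$, $\varphi_n(a_{n+1})=a_n$. A morphism $\{(V_n,\varphi_n)\}\to\{(W_n,\psi_n)\}$ consists of an order-preserving $g\colon\mathbb N\to\mathbb N$ (possibly defined only for large arguments) and morphisms of varieties $f_j\colon V_{g(j)}\to W_j$ with $f_j\circ\varphi^{g(j')}_{g(j)}=\psi^{j'}_j\circ f_{j'}$ for $j\le j'$; it induces a map on points. An isomorphism is a morphism with an inverse morphism, i.e. the induced maps on points are mutually inverse. *)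

(* Defs.v *)
From HB Require Import structures.
From mathcomp Require Import all_boot all_order all_algebra.
From mathcomp Require Import finmap monalg.
From mathcomp Require Import all_classical topology cantor.

Set Implicit Arguments.
Unset Strict Implicit.
Unset Printing Implicit Defensive.

Import GRing.Theory.
Local Open Scope classical_set_scope.
Local Open Scope ring_scope.

(** * Monomial algebras *)

Definition two_sided_ideal (R : nzRingType) (S : set R) : set R :=
  [set p | exists (n : nat) (a b c : 'I_n -> R),
     (forall i, S (b i)) /\ p = \sum_i a i * b i * c i].

(** [{malg F[{fmonom 'I_m}]}] is the free associative algebra F<x_1, ..., x_m>;
    [<< w >>] is the word [w], and [<< fmu j >>] the variable x_j.  The algebra
    is given up to isomorphism: an F-algebra with a surjection from the free
    algebra whose kernel is generated by words.  It is nonzero since an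
    [algType] is, so that the kernel is a proper ideal. *)
Record monomial_algebra (F : fieldType) := MonomialAlgebra {
  ngen : nat;
  malgebra :> algType F;
  pres : {lrmorphism {malg F[{fmonom 'I_ngen}]} -> malgebra};
  rels : set {fmonom 'I_ngen};
  pres_surj : forall a : malgebra, exists p, pres p = a;
  pres_ker : forall p,
    pres p = 0 <-> two_sided_ideal [set << w >> | w in rels] p;
  pres_gen_neq0 : forall j, pres << fmu j >> != 0
}.

Definition var (F : fieldType) (A : monomial_algebra F) (j : 'I_(ngen A)) : A :=
  pres A << fmu j >>.

Definition homog_comp (F : fieldType) (A : monomial_algebra F) (n : nat)
    : set A :=
  [set pres A p | p in [set p | forall w, w \in msupp p -> fdeg w = n]].
Arguments homog_comp {F} A n.

Definition has_dim (K : fieldType) (V : lmodType K) (S : set V) (n : nat) :=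
  exists b : 'I_n -> V,
    (forall v, S v <-> exists c : 'I_n -> K, v = \sum_i c i *: b i) /\
    (forall c : 'I_n -> K, \sum_i c i *: b i = 0 -> forall i, c i = 0).

(** H_A(t) (1 - t)^2 = 1 as formal power series: the coefficient of t^N in the
    product only involves the terms of H_A of degree at most N. *)
Definition hilbert_series_P1 (F : fieldType) (A : monomial_algebra F) :=
  exists h : nat -> nat,
    (forall n, has_dim (homog_comp A n) (h n)) /\
    (forall N, ((\poly_(n < N.+1) (h n)%:Z) * (1 - 'X) ^+ 2)`_N
               = (N == 0%N)%:R).

Definition prime_ring (R : nzRingType) :=
  forall a b : R, (forall r, a * r * b = 0) -> a = 0 \/ b = 0.

Definition monomial_P1 (F : fieldType) (A : monomial_algebra F) :=
  prime_ring A /\ hilbert_series_P1 A.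

(** * Points of projective spaces, Zariski topology *)

(** Points of P^(m-1) over K are the lines of K^m. *)
Definition proj (K : fieldType) (m : nat) :=
  {U : {vspace 'rV[K]_m} | \dim U == 1%N}.

(** (P^(m-1))^r *)
Definition mproj (K : fieldType) (r m : nat) := {ffun 'I_r -> proj K m}.

HB.instance Definition _ (K : fieldType) (r m : nat) := Choice.on (mproj K r m).

Definition hcoord (K : fieldType) (r m : nat) (x : mproj K r m)
    (i : 'I_r) (j : 'I_m) : K := vpick (val (x i)) 0 j.

(** Polynomials in the homogeneous coordinates X_(i,j), i < r, j < m. *)
Definition mpol (F : fieldType) (r m : nat) :=
  {malg F[{cmonom ('I_r * 'I_m)%type}]}.

Definition multihomog (F : fieldType) (r m : nat) (d : 'I_r -> nat)
    (p : mpol F r m) :=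
  forall w, w \in msupp p -> forall i, (\sum_j w (i, j))%N = d i.

Definition is_multihomog (F : fieldType) (r m : nat) (p : mpol F r m) :=
  exists d, multihomog d p.

(** Evaluation at the homogeneous coordinates chosen by [hcoord]; only used for
    multihomogeneous polynomials, where the choice is immaterial. *)
Definition peval (F K : fieldType) (iota : {rmorphism F -> K}) (r m : nat)
    (x : mproj K r m) (p : mpol F r m) : K :=
  mmap iota (fun w : {cmonom ('I_r * 'I_m)%type} =>
               \prod_i \prod_j hcoord x i j ^+ w (i, j)) p.

Definition idF (F : fieldType) : {rmorphism F -> F} := idfun.

Definition zariski_basic (F : fieldType) (r m : nat) : set (set (mproj F r m)) :=
  [set [set x | peval (idF F) x p <> 0] | p in @is_multihomog F r m].

HB.instance Definition _ (F : fieldType) (r m : nat) :=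
  isSubBaseTopological.Build (mproj F r m) (@zariski_basic F r m) id.

(** P^(m-1) x P^(m-1) x ..., with the inverse limit of the Zariski topologies
    of the finite products. *)
Definition pseq (K : fieldType) (m : nat) := nat -> proj K m.

HB.instance Definition _ (K : fieldType) (m : nat) := Choice.on (pseq K m).

Definition trunc (K : fieldType) (m n : nat) (l : pseq K m) : mproj K n.+1 m :=
  [ffun i : 'I_n.+1 => l i].

HB.instance Definition _ (F : fieldType) (m : nat) :=
  Topological.copy (pseq F m)
    (sup_topology (fun n => Topological.on
       (initial_topology (@trunc F m n : pseq F m -> mproj F n.+1 m)))).

Definition homeomorphic (X Y : topologicalType) :=
  exists (f : X -> Y) (g : Y -> X),
    [/\ cancel f g, cancel g f, continuous f & continuous g].

(** * Varieties and their morphisms *)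

(** F need not be algebraically closed (it may even be finite), so a subset of
    (P^(c-1))^r is given by its points over all field extensions of F, and
    equations, respectively formulas for morphisms, have coefficients in F and
    are valid over all extensions.  For algebraically closed F this is the
    classical notion on F-points. *)
Record psubset (F : fieldType) := PSubset {
  nfac : nat;
  ncoord : nat;
  points : forall (K : fieldType) (iota : {rmorphism F -> K}),
    set (mproj K nfac ncoord)
}.
Arguments points {F} X {K} iota : rename.

Definition closed_variety (F : fieldType) (X : psubset F) :=
  exists S : set (mpol F (nfac X) (ncoord X)),
    (forall p, S p -> is_multihomog p) /\
    (forall (K : fieldType) (iota : {rmorphism F -> K}) x,
       points X iota x <-> forall p, S p -> peval iota x p = 0).

Definition point_map (F : fieldType) (X Y : psubset F) :=
  forall (K : fieldType) (iota : {rmorphism F -> K}),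
    points X iota -> points Y iota.

(** [f] is a morphism of varieties: around every point, each component of [f]
    is [q_1 : ... : q_c] for polynomials q_j of the same multidegree without
    common zero on a neighbourhood [h <> 0]. *)
Definition regular (F : fieldType) (X Y : psubset F) (f : point_map X Y) :=
  forall (K : fieldType) (iota : {rmorphism F -> K}) (x : points X iota)
         (i : 'I_(nfac Y)),
  exists (h : mpol F (nfac X) (ncoord X))
         (q : 'I_(ncoord Y) -> mpol F (nfac X) (ncoord X)),
    [/\ is_multihomog h,
        exists d, forall j, multihomog d (q j),
        peval iota (val x) h <> 0 &
        forall (K' : fieldType) (iota' : {rmorphism F -> K'})
               (y : points X iota'),
          peval iota' (val y) h <> 0 ->
          val (val (f K' iota' y) i)
            = <[\row_j peval iota' (val y) (q j)]>%VS].

(** * Proalgebraic varieties *)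

Record prosystem (F : fieldType) := ProSystem {
  level : nat -> psubset F;
  bond : forall n, point_map (level n.+1) (level n)
}.
Arguments bond {F} V n [K iota] _ : rename.

Definition proalgebraic (F : fieldType) (V : prosystem F) :=
  forall n,
    [/\ closed_variety (level V n),
        regular (bond V n) &
        forall (K : fieldType) (iota : {rmorphism F -> K})
               (y : points (level V n) iota),
          exists x, bond V n x = y].

Section Transition.
Variables (F : fieldType) (V : prosystem F).
Variables (K : fieldType) (iota : {rmorphism F -> K}).

Fixpoint transition_add (i k : nat) :
    points (level V (k + i)) iota -> points (level V i) iota :=
  match k with
  | 0 => id
  | k'.+1 => fun x => transition_add (bond V (k' + i) x)
  end.

(** The composite V_i' -> V_i of the bonding maps. *)
Definition transition (i i' : nat) (le_ii' : (i <= i')%N)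
    (x : points (level V i') iota) : points (level V i) iota :=
  transition_add (ecast n (points (level V n) iota) (esym (subnK le_ii')) x).

Definition propoint :=
  {a : forall n, points (level V n) iota | forall n, bond V n (a n.+1) = a n}.

End Transition.

(** [pro_idx] is only meaningful from index [pro_start] on. *)
Record promorphism (F : fieldType) (V W : prosystem F) := ProMorphism {
  pro_start : nat;
  pro_idx : nat -> nat;
  pro_idx_mono : forall j j',
    (pro_start <= j)%N -> (j <= j')%N -> (pro_idx j <= pro_idx j')%N;
  pro_map : forall j,
    (pro_start <= j)%N -> point_map (level V (pro_idx j)) (level W j);
  pro_map_regular : forall j (hj : (pro_start <= j)%N), regular (pro_map hj);
  pro_map_transition :
    forall j j' (hj : (pro_start <= j)%N) (hj' : (pro_start <= j')%N)
           (le_jj' : (j <= j')%N) (K : fieldType) (iota : {rmorphism F -> K})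
           (x : points (level V (pro_idx j')) iota),
      pro_map hj (transition (pro_idx_mono hj le_jj') x)
      = transition le_jj' (pro_map hj' x)
}.
Arguments pro_map {F V W} M [j] hj [K iota] _ : rename.

(** The graph of the map on points induced by [M].  It is the graph of a map,
    since a point of W is determined by its components of index >= pro_start. *)
Definition induced (F : fieldType) (V W : prosystem F) (M : promorphism V W)
    (K : fieldType) (iota : {rmorphism F -> K})
    (a : propoint V iota) (b : propoint W iota) :=
  forall j (hj : (pro_start M <= j)%N),
    pro_map M hj (proj1_sig a (pro_idx M j)) = proj1_sig b j.

Definition pro_iso (F : fieldType) (V W : prosystem F) :=
  [/\ proalgebraic V, proalgebraic W &
      exists (M : promorphism V W) (N : promorphism W V),
        forall (K : fieldType) (iota : {rmorphism F -> K})
               (a : propoint V iota) (b : propoint W iota),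
          induced M a b <-> induced N b a].

(** P^1, as a constant inverse system. *)
Definition proj_line (F : fieldType) : psubset F :=
  @PSubset F 1 2 (fun K iota => setT).

Definition const_proj_line (F : fieldType) : prosystem F :=
  @ProSystem F (fun _ => proj_line F) (fun _ K iota => id).

(** Sets of points in P^(m-1) x P^(m-1) x ... over all extensions of F, and the
    inverse system of their projections to the first n + 1 factors. *)
Definition seqset (F : fieldType) (m : nat) :=
  forall (K : fieldType) (iota : {rmorphism F -> K}), set (pseq K m).

Definition seqset_level (F : fieldType) (m : nat) (X : seqset F m) (n : nat)
    : psubset F :=
  @PSubset F n.+1 m (fun K iota => @trunc K m n @` X K iota).

Definition drop_last (K : fieldType) (m n : nat) (x : mproj K n.+2 m)
    : mproj K n.+1 m :=
  [ffun i : 'I_n.+1 => x (widen_ord (leqnSn n.+1) i)].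

Lemma drop_last_level (F : fieldType) (m : nat) (X : seqset F m) (n : nat)
    (K : fieldType) (iota : {rmorphism F -> K}) (x : mproj K n.+2 m) :
  points (seqset_level X n.+1) iota x ->
  points (seqset_level X n) iota (drop_last x).
Proof. by case=> l Xl <-; exists l => //; apply/ffunP => i; rewrite !ffunE. Qed.

Definition seqset_prosystem (F : fieldType) (m : nat) (X : seqset F m)
    : prosystem F :=
  @ProSystem F (seqset_level X) (fun n K iota x =>
    SigSub (mem_set (drop_last_level (set_mem (valP x))))).

(** * Point modules *)

(** A right module over A tensor K, that is, a K-vector space with a compatible
    right action of A; for K = F, a right A-module. *)
Record right_module (F : fieldType) (A : algType F)
    (K : fieldType) (iota : {rmorphism F -> K}) := RightModule {
  rmod :> lmodType K;
  ract : rmod -> A -> rmod;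
  ractDl : forall v w a, ract (v + w) a = ract v a + ract w a;
  ractDr : forall v a b, ract v (a + b) = ract v a + ract v b;
  ractZl : forall c v a, ract (c *: v) a = c *: ract v a;
  ractZr : forall c v a, ract v (c *: a) = iota c *: ract v a;
  ract1 : forall v, ract v 1 = v;
  ractM : forall v a b, ract v (a * b) = ract (ract v a) b
}.

(** A point module over A tensor K.  In [pcomp_cyclic], the sum is the action on
    e0 of an element of A tensor K; for K = F it is just e0 a with a in A. *)
Record point_module (F : fieldType) (A : monomial_algebra F)
    (K : fieldType) (iota : {rmorphism F -> K}) := PointModule {
  pmod :> right_module A iota;
  pcomp : nat -> set pmod;
  pcomp_dim1 : forall n, has_dim (pcomp n) 1;
  pcomp_span : forall v : pmod, exists (n : nat) (w : nat -> pmod),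
    (forall i, pcomp i (w i)) /\ v = \sum_(i < n) w i;
  pcomp_direct : forall (n : nat) (w : nat -> pmod),
    (forall i, pcomp i (w i)) -> \sum_(i < n) w i = 0 ->
    forall i, (i < n)%N -> w i = 0;
  pcomp_graded : forall i n (v : pmod) (a : A),
    pcomp i v -> homog_comp A n a -> pcomp (i + n) (ract v a);
  pcomp_cyclic : exists2 e0, pcomp 0 e0 &
    forall v : pmod, exists (n : nat) (c : 'I_n -> K) (a : 'I_n -> A),
      v = \sum_k c k *: ract e0 (a k)
}.

(** P_i = K e_i, e_i x_j = c_ij e_(i+1), and l_i = [c_i1 : ... : c_im]. *)
Definition records (F : fieldType) (A : monomial_algebra F)
    (K : fieldType) (iota : {rmorphism F -> K}) (P : point_module A iota)
    (l : pseq K (ngen A)) :=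
  exists (e : nat -> P) (c : nat -> 'rV[K]_(ngen A)),
    [/\ forall i, pcomp i (e i) /\ e i <> 0,
        forall i j, ract (e i) (var j) = c i 0 j *: e i.+1 &
        forall i, val (l i) = <[c i]>%VS].

Definition limP (F : fieldType) (A : monomial_algebra F) : seqset F (ngen A) :=
  fun K iota => [set l | exists P : point_module A iota, records P l].
Arguments limP {F} A [K] iota _.

(** The proalgebraic variety P(A) of point modules. *)
Definition PA (F : fieldType) (A : monomial_algebra F) : prosystem F :=
  seqset_prosystem (limP A).

(** A closed sub-pro-variety of P(A), given by its points, that is isomorphic to
    the projective line. *)
Definition projective_line (F : fieldType) (A : monomial_algebra F)
    (L : seqset F (ngen A)) :=
  [/\ forall (K : fieldType) (iota : {rmorphism F -> K}),
        L K iota `<=` limP A iota,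
      forall (K : fieldType) (iota : {rmorphism F -> K}) (l : pseq K (ngen A)),
        (forall n, points (seqset_level L n) iota (trunc n l)) -> L K iota l &
      pro_iso (seqset_prosystem L) (const_proj_line F)].

(* Main.v *)
Require Import Defs.
From mathcomp Require Import all_boot all_order all_algebra.
From mathcomp Require Import finmap monalg zify.
From mathcomp Require Import all_classical topology cantor.

(** The nonzero words of a monomial P^1 form a language L that is factorial,
    irreducible (primeness) and has n + 1 words of each length n; so L has
    exactly one left special and one right special word of each length, and the
    left special ones are the prefixes of one infinite word c.

    A point of P(A) over K is a sequence of points of P^1(K) such that every
    word read along its nonzero coordinates is in L.  If the point has two
    nonzero coordinates at position i, then both letters can precede the rest,
    which is therefore c; and if i > 0, the letter a before position i makes
    a a c an infinite word of L, which is impossible.  So i = 0, and the points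
    are the sequences (x, c) with x in P^1 together with the infinite words of
    L; these form a Cantor set S, and the line meets S in 0c and 1c.

    The system is thus determined by the pair (S, c).  A homeomorphism between
    two such Cantor sets that maps bc to bc' for both letters b is uniformly
    continuous, hence descends to the levels, where it is glued with the
    identity of P^1; on each level the line and the finitely many remaining
    points are separated by monomials, so the glued maps are regular. *)

Set Implicit Arguments.
Unset Strict Implicit.
Unset Printing Implicit Defensive.

Local Open Scope classical_set_scope.

(** * Words of complexity n + 1 *)

Definition agree (n : nat) (u v : nat -> bool) := forall i, i < n -> u i = v i.

Definition bcons (b : bool) (u : nat -> bool) : nat -> bool :=
  fun n => if n is k.+1 then u k else b.

(** For the nonzero words, the fields come in turn from multiplication (a product with a zero factor
    is zero), from primeness and from the Hilbert series. *)
Record sturmian (L : pred (seq bool)) := Sturmian {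
  sturm_factor : forall u v w, L (u ++ v ++ w) -> L v;
  sturm_irred : forall u v, L u -> L v -> exists w, L (u ++ w ++ v);
  sturm_count : forall n, exists W : seq (seq bool),
    [/\ uniq W, size W = n.+1 & forall s, (s \in W) = L s && (size s == n)]
}.

Lemma sturmian_rev L : sturmian L -> sturmian (fun s => L (rev s)).
Proof.
move=> [Lf Li Lc]; split=> [u v w|u v Lu Lv|n].
- by rewrite !rev_cat -catA; apply: Lf.
- by have [w Lw] := Li _ _ Lv Lu; exists (rev w); rewrite !rev_cat revK -catA.
- have [W [uW sW WE]] := Lc n; exists (map rev W).
  split=> [||s]; [by rewrite map_inj_uniq //; exact: (can_inj revK)|by rewrite size_map|].
  by rewrite -[s in LHS]revK mem_map ?WE ?size_rev //; exact: (can_inj revK).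
Qed.

Section SturmianWords.
Variable L : pred (seq bool).
Hypothesis LS : sturmian L.
Implicit Types (a b : bool) (s t : seq bool) (u v : nat -> bool).
Let Lf := sturm_factor LS.
Let Li := sturm_irred LS.

Lemma sturm_nil : L [::].
Proof.
have [[|s W] [_ //= _ WE]] := sturm_count LS 0.
by apply: (@Lf [::] _ s); have := WE s; rewrite mem_head => /esym/andP[].
Qed.

Lemma sturm_letter b : L [:: b].
Proof.
have [W [uW sW WE]] := sturm_count LS 1.
have sub : {subset W <= [:: [:: true]; [:: false]]}.
  by move=> [|[] [|? ?]]; rewrite WE ?andbF // !inE.
have [_ E] := uniq_min_size uW sub (eq_leq (esym sW)).
by have := E [:: b]; rewrite WE andbT => ->; case: b; rewrite !inE.
Qed.

Lemma sturm_prefix s t : L (s ++ t) -> L s.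
Proof. by move=> Lst; apply: (@Lf [::] _ t). Qed.

Lemma sturm_suffix s t : L (s ++ t) -> L t.
Proof. by move=> Lst; apply: (@Lf s _ [::]); rewrite cats0. Qed.

Lemma sturm_rcons s : L s -> exists b, L (rcons s b).
Proof.
move=> Ls; have [[|b w] Lw] := Li Ls (sturm_letter true).
  by exists true; rewrite -cats1.
exists b; rewrite -cats1; apply: (@sturm_prefix _ (w ++ [:: true])).
by rewrite -catA.
Qed.

Definition right_special s := L (rcons s true) && L (rcons s false).

(** Counting: each of the n + 1 words of length n has a right extension, and two distinct right
    special words would give two more, hence n + 3 words of length n + 1 instead of n + 2. *)
Lemma right_special_uniq s t : right_special s -> right_special t ->
  size s = size t -> s = t.
Proof.
move=> /andP[s1 s0] /andP[t1 t0] st; apply/eqP; apply: contraT => nst.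
have [W [uW sW WE]] := sturm_count LS (size s).
have [W' [_ sW' W'E]] := sturm_count LS (size s).+1.
(* [f] appends [true] whenever possible, so the extension of a right special word by [false] is
   never a value of [f]. *)
pose f r := rcons r (L (rcons r true)).
have f_inj : injective f by move=> x y /rcons_inj[].
pose Z := rcons s false :: rcons t false :: map f W.
have fN r : L (rcons r true) -> rcons r false \notin map f W.
  move=> r1; apply/mapP => -[x _] /rcons_inj[<-]; by rewrite r1.
have uZ : uniq Z.
  rewrite /= inE negb_or !fN // map_inj_uniq // uW.
  by rewrite eqseq_rcons (negbTE nst).
have sub : {subset Z <= W'}.
  move=> x; rewrite W'E !inE => /or3P[/eqP->|/eqP->|/mapP[y + ->]].
  - by rewrite size_rcons s0 eqxx.
  - by rewrite size_rcons t0 st eqxx.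
  - rewrite WE => /andP[/sturm_rcons[b yb] /eqP sy].
    rewrite /f size_rcons sy eqxx andbT.
    by case: (boolP (L (rcons y true))); case: b yb => // ->.
by have := uniq_leq_size uZ sub; rewrite /= size_map sW sW' ltnn.
Qed.

(** Otherwise deleting the last letter would inject the n + 2 words of length n + 1 into the n + 1
    words of length n. *)
Lemma right_special_ex n : exists2 s, size s = n & right_special s.
Proof.
have [W [uW sW WE]] := sturm_count LS n.
have [W' [uW' sW' W'E]] := sturm_count LS n.+1.
apply: contrapT => nR.
have sub : {subset map (take n) W' <= W}.
  move=> x /mapP[y]; rewrite W'E => /andP[Ly /eqP sy] ->.
  rewrite WE size_take sy ltnSn eqxx andbT.
  by apply: (@sturm_prefix _ (drop n y)); rewrite cat_take_drop.
have inj : {in W' &, injective (take n)}.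
  move=> x y; rewrite !W'E => /andP[Lx /eqP sx] /andP[Ly /eqP sy].
  case/lastP: x Lx sx => // x b Lx; rewrite size_rcons => -[sx].
  case/lastP: y Ly sy => // y d Ly; rewrite size_rcons => -[sy].
  rewrite -!cats1 !take_size_cat // => xy; congr (_ ++ [:: _]) => //.
  apply: contra_notP nR => bd; exists x => //; subst y.
  by move: Lx Ly; rewrite /right_special; case: b d bd => [] [] // _ -> ->.
have := uniq_leq_size (_ : uniq (map (take n) W')) sub.
by rewrite map_inj_in_uniq // size_map sW sW' ltnn => /(_ uW').
Qed.

End SturmianWords.

(** * Left special words and the one-sided shift space *)

Section SturmianShift.
Variable L : pred (seq bool).
Hypothesis LS : sturmian L.
Implicit Types (a b : bool) (s t : seq bool) (u v : nat -> bool).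
Let Lf := sturm_factor LS.
Let Li := sturm_irred LS.

Definition left_special s := L (true :: s) && L (false :: s).

Lemma left_special_rev s : left_special s = right_special (fun s => L (rev s)) (rev s).
Proof. by rewrite /left_special /right_special !rev_rcons revK. Qed.

Lemma left_special_uniq s t : left_special s -> left_special t ->
  size s = size t -> s = t.
Proof.
rewrite !left_special_rev => s1 t1 st; apply: (can_inj revK).
by apply: (right_special_uniq (sturmian_rev LS)) => //; rewrite !size_rev.
Qed.

Lemma left_special_ex n : exists2 s, size s = n & left_special s.
Proof.
have [s sn sR] := right_special_ex (sturmian_rev LS) n.
by exists (rev s); rewrite ?size_rev // left_special_rev revK.
Qed.

Lemma left_special_take n s : left_special s -> left_special (take n s).
Proof.
move=> /andP[s1 s0]; apply/andP; split; apply: (sturm_prefix LS (t := drop n s));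
  by rewrite /= cat_take_drop.
Qed.

(** Testing prefixes is enough: [L] is closed under factors, so all factors of such a sequence are
    in [L]. *)
Definition shift_space : set (nat -> bool) := [set u | forall n, L (mkseq u n)].

Lemma mkseq_agree n u v : mkseq u n = mkseq v n <-> agree n u v.
Proof.
split=> [uv i ni|uv]; last by apply/eq_in_map => i; rewrite mem_iota => /uv.
by have := congr1 (fun s => nth false s i) uv; rewrite !nth_mkseq.
Qed.

Lemma take_mkseq n k u : n <= k -> take n (mkseq u k) = mkseq u n.
Proof. by move=> nk; rewrite /mkseq -map_take take_iota (minn_idPl nk). Qed.

Lemma mkseqD n k u : mkseq u (n + k) = mkseq u n ++ mkseq (fun i => u (n + i)) k.
Proof. by rewrite /mkseq iotaD map_cat add0n -[in iota n k](addn0 n) iotaDl -map_comp. Qed.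

Lemma mkseq_bcons b u n : mkseq (bcons b u) n.+1 = b :: mkseq u n.
Proof. by rewrite -add1n mkseqD. Qed.

Lemma shift_space_shift u k : shift_space u -> shift_space (fun i => u (k + i)).
Proof. by move=> Su n; apply: (sturm_suffix LS (s := mkseq u k)); rewrite -mkseqD. Qed.

Lemma ex_limit_word (p : nat -> seq bool) :
  (forall n, size (p n) = n) -> (forall n, take n (p n.+1) = p n) ->
  exists u, forall n, mkseq u n = p n.
Proof.
move=> ps pt; exists (fun i => nth false (p i.+1) i) => n.
apply: (@eq_from_nth _ false); rewrite size_mkseq ?ps // => i ni.
rewrite nth_mkseq //; have [k ->] : exists k, n = i.+1 + k by exists (n - i.+1); lia.
elim: k => [|k IH]; first by rewrite addn0.
by rewrite IH addnS -pt nth_take //; lia.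
Qed.

Lemma shift_space_closed u :
  (forall n, exists2 v, shift_space v & agree n u v) -> shift_space u.
Proof. by move=> uc n; have [v Sv /mkseq_agree ->] := uc n. Qed.

Lemma shift_space_extend s : L s -> exists2 u, shift_space u & mkseq u (size s) = s.
Proof.
move=> Ls.
have /choice[g gP] : forall t, exists b, L t -> L (rcons t b).
  move=> t; have [/(sturm_rcons LS)[b Lb]|nt] := boolP (L t); first by exists b.
  by exists true.
pose q := fix q n := if n is k.+1 then rcons (q k) (g (q k)) else s.
have Lq n : L (q n) by elim: n => // n /gP.
have sq n : size (q n) = size s + n.
  by elim: n => [|n IH] /=; rewrite ?addn0 // size_rcons IH addnS.
(* [q n] has length [size s + n], at least n, and later [q] only append letters; so these prefixes
   are nested. *)
pose p n := take n (q n).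
have pq n k : take n (q (n + k)) = p n.
  elim: k => [|k IH]; first by rewrite addn0.
  by rewrite addnS /= -cats1 takel_cat // sq; lia.
have [u uP] : exists u, forall n, mkseq u n = p n.
  apply: ex_limit_word => n; first by rewrite size_takel // sq; lia.
  by rewrite /p take_takel // -[n.+1]addn1 pq.
exists u => [n|]; rewrite uP.
  by apply: (sturm_prefix LS (t := drop n (q n))); rewrite cat_take_drop.
rewrite /p; elim: {2}(size s) => [|k IH] /=; first by rewrite take_size.
by rewrite -cats1 takel_cat // sq; lia.
Qed.

(** Prefixes of left special words are left special; uniqueness in each length therefore nests the
    left special words. *)
Lemma left_special_word :
  exists c, forall n, left_special (mkseq c n).
Proof.
have /all_sig2[p ps pS] := fun n => cid2 (left_special_ex n).
have [c cP] : exists c, forall n, mkseq c n = p n.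
  apply: ex_limit_word => // n; apply: left_special_uniq => //.
    exact: left_special_take.
  by rewrite size_takel !ps.
by exists c => n; rewrite cP.
Qed.

Section LeftSpecialWord.
Variable c : nat -> bool.
Hypothesis cS : forall n, left_special (mkseq c n).

Lemma shift_space_bcons b : shift_space (bcons b c).
Proof.
case=> [|n]; first exact: sturm_nil.
by rewrite mkseq_bcons; case/andP: (cS n); case: b.
Qed.

Lemma bcons_shift_space u : (forall b, shift_space (bcons b u)) -> u = c.
Proof.
move=> uS; suff uc n : mkseq u n = mkseq c n.
  by apply/funext => i; have /mkseq_agree -> := uc i.+1.
apply: left_special_uniq; rewrite ?size_mkseq //.
by apply/andP; split; rewrite -mkseq_bcons; apply: uS.
Qed.

(** Read [w] from its right end: a letter [a] joins the final block and lengthens it, and the first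
    letter [~~ a] met ends the search. *)
Lemma sturm_block a w j : L (~~ a :: w ++ nseq j a) -> L (~~ a :: nseq j a).
Proof.
elim/last_ind: w j => [//|w x IH] j; rewrite cat_rcons.
have [->|/negPf xa] := eqVneq x (~~ a).
  by rewrite -cat_cons => /(sturm_suffix LS).
have -> : x = a by move: xa; case: (a); case: (x).
move/(IH j.+1).
by rewrite -[j.+1]addn1 nseqD -cat_cons => /(sturm_prefix LS).
Qed.

Lemma sturm_blockr a w j : L (nseq j a ++ w ++ [:: ~~ a]) -> L (nseq j a ++ [:: ~~ a]).
Proof.
elim: w j => [//|x w IH] j.
have [->|/negPf xa] := eqVneq x (~~ a).
  by rewrite cat_cons -cat1s catA => /(sturm_prefix LS).
have -> : x = a by move: xa; case: (a); case: (x).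
rewrite cat_cons -cat1s catA -[[:: a]]/(nseq 1 a) -nseqD addn1 => /(IH j.+1).
by rewrite -add1n nseqD -catA => /(sturm_suffix LS).
Qed.

(** Irreducibility gives a word between two letters [~~ a]; it is cut at its first [~~ a], the
    induction counting in [j] the letters [a] read so far. *)
Lemma sturm_return a : exists k, L (~~ a :: nseq k a ++ [:: ~~ a]).
Proof.
have [w] := Li (sturm_letter LS (~~ a)) (sturm_letter LS (~~ a)).
rewrite -[[:: _] ++ _]/((~~ a :: nseq 0 a) ++ w ++ [:: ~~ a]).
elim: w (0) => [j|x w IH j]; first by exists j.
have [->|/negPf xa] := eqVneq x (~~ a).
  rewrite -[_ :: w]cat1s -catA catA => /(sturm_prefix LS) Lj.
  by exists j.
have -> : x = a by move: xa; case: (a); case: (x).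
rewrite -[_ :: w]cat1s -catA catA cat_cons -[[:: a]]/(nseq 1 a) -nseqD addn1.
exact: IH.
Qed.

(** Otherwise every a^k is left special, hence a prefix of c, and right special;
    but so is b a^k for the length k of some block b a^k b. *)
Lemma shift_space_double a : ~ shift_space (bcons a (bcons a c)).
Proof.
move=> aac.
have bak k : L (nseq k a) -> L (~~ a :: nseq k a).
  move=> Lk; have [w Lw] := Li (sturm_letter LS (~~ a)) Lk.
  exact: (@sturm_block a w).
have ck k : mkseq c k = nseq k a.
  elim: k => [//|k IH]; have := aac k.+2; rewrite !mkseq_bcons IH => Lk.
  apply: left_special_uniq => //; last by rewrite size_mkseq size_nseq.
  have := bak k.+1 (sturm_suffix LS (s := [:: a]) Lk).
  by rewrite /left_special /=; case: a Lk {aac bak IH} => -> ->.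
have La k : L (nseq k a).
  by rewrite -ck; apply: (sturm_suffix LS (s := [:: true])); case/andP: (cS k).
have [k Lk] := sturm_return a.
suff : ~~ a :: nseq k a = nseq k.+1 a by case; case: (a).
apply: (right_special_uniq LS); last by rewrite /= !size_nseq.
  rewrite /right_special -!cats1; have := bak _ (La k.+1).
  rewrite -[k.+1]addn1 nseqD; move: Lk; rewrite -!cat_cons.
  by case: (a) => /= -> ->.
have [w Lw] := Li (La k.+1) (sturm_letter LS (~~ a)).
have := sturm_blockr Lw; have := La k.+2.
rewrite -[k.+2]addn1 nseqD /right_special -!cats1.
by case: (a) => /= -> ->.
Qed.

End LeftSpecialWord.

(** A word with only one infinite extension recurs in it, so that this extension is
    periodic; as it contains all the words, there would be boundedly many of each
    length. *)
Lemma shift_space_perfect u n : shift_space u ->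
  exists v, [/\ shift_space v, agree n u v & u <> v].
Proof.
move=> Su; apply: contrapT => nv.
pose w := mkseq u n.+1.
have wu v : shift_space v -> mkseq v n.+1 = w -> v = u.
  move=> Sv vw; apply: contra_notP nv => vu; exists v; split=> //; last exact: nesym.
  by move=> i ni; have /mkseq_agree -> // := vw; rewrite ltnS ltnW.
have [z Lz] := Li (Su n.+1) (Su n.+1).
have occ s : L (w ++ s) -> mkseq u (n.+1 + size s) = w ++ s.
  move=> Ls; have [v Sv vE] := shift_space_extend Ls.
  move: vE; rewrite size_cat size_mkseq => vE; rewrite -[in LHS](wu v) //.
  by rewrite -(@take_mkseq _ (n.+1 + size s)) ?leq_addr // vE take_size_cat // size_mkseq.
(* The two occurrences of [w] in [w ++ z ++ w] start [p] letters apart, and each determines all that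
   follows; [p] is thus a period of [u]. *)
pose p := n.+1 + size z.
have up : (fun i => u (p + i)) = u.
  apply: wu; first exact: shift_space_shift.
  have := occ _ Lz; rewrite size_cat size_mkseq addnA mkseqD catA => /eqP.
  by rewrite eqseq_cat ?size_mkseq ?size_cat ?size_mkseq // => /andP[_ /eqP].
have umod i : u i = u (i %% p).
  rewrite {1}(divn_eq i p); elim: (i %/ p) => [//|k IH].
  by rewrite mulSn -addnA -[LHS]/((fun i => u (p + i)) _) up.
have [W [uW sW WE]] := sturm_count LS p.
have sub : {subset W <= map (fun i => mkseq (fun k => u (i + k)) p) (iota 0 p)}.
  move=> s; rewrite WE => /andP[Ls /eqP sp].
  have [y Ly] := Li (Su n.+1) Ls.
  apply/mapP; exists ((n.+1 + size y) %% p); first by rewrite mem_iota add0n ltn_mod.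
  have := occ _ Ly; rewrite size_cat addnA mkseqD catA => /eqP.
  rewrite eqseq_cat ?size_mkseq ?size_cat ?size_mkseq // => /andP[_ /eqP <-].
  rewrite sp; apply/eq_map => k; rewrite umod [RHS]umod.
  by rewrite modnDml.
by have := uniq_leq_size uW sub; rewrite sW size_map size_iota ltnn.
Qed.

End SturmianShift.

(** * Cantor sets of binary sequences *)

Lemma agree_sym n u v : agree n u v -> agree n v u.
Proof. by move=> uv i /uv. Qed.

Lemma agree_trans n u v w : agree n u v -> agree n v w -> agree n u w.
Proof. by move=> uv vw i ni; rewrite uv ?vw. Qed.

Lemma agree_le n k u v : n <= k -> agree k u v -> agree n u v.
Proof. by move=> nk uv i ni; apply: uv; apply: leq_trans nk. Qed.

Lemma agreeS n u v : agree n u v -> u n = v n -> agree n.+1 u v.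
Proof. by move=> uv un i; rewrite ltnS leq_eqVlt => /orP[/eqP ->|/uv]. Qed.

Lemma agree_limit (v : nat -> nat -> bool) :
  (forall n, agree n (v n) (v n.+1)) ->
  forall n, agree n (fun i => v i.+1 i) (v n).
Proof.
move=> vS n i ni; rewrite -(subnK ni); elim: (n - i.+1) => [//|k ->].
by rewrite addSn vS // leq_addl.
Qed.

Definition seq_closed (S : set (nat -> bool)) :=
  forall u, (forall n, exists2 v, S v & agree n u v) -> S u.

Definition seq_perfect (S : set (nat -> bool)) :=
  forall u n, S u -> exists v, [/\ S v, agree n u v & u <> v].

Definition unif_cont (S : set (nat -> bool)) (f : (nat -> bool) -> nat -> bool) :=
  forall k, exists N, forall u v, S u -> S v -> agree N u v -> agree k (f u) (f v).

(** Compactness of [S]: if no bound is uniform, prefixes shared by counterexamples to every bound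
    can be prolonged forever, and their limit in [S] contradicts the pointwise bound. *)
Lemma konig (S : set (nat -> bool)) (P : nat -> (nat -> bool) -> Prop) :
  seq_closed S ->
  (forall n k u, n <= k -> P n u -> P k u) ->
  (forall n u v, agree n u v -> P n u -> P n v) ->
  (forall u, S u -> exists n, P n u) ->
  exists n, forall u, S u -> P n u.
Proof.
move=> Sc Pmono Pagree Pex; apply: contrapT => nP.
pose bad n v := S v /\ forall N, exists w, [/\ S w, agree n v w & ~ P N w].
have ex0 N : exists2 v, S v & ~ P N v.
  apply: contra_notP nP => nv; exists N => u Su.
  by apply: contra_notP nv => nPu; exists u.
have [v0 bad0] : exists v, bad 0 v.
  have [v Sv _] := ex0 0; exists v; split=> // N.
  by have [w Sw nw] := ex0 N; exists w.
have /choice[g gP] : forall nv, exists w, bad nv.1 nv.2 -> agree nv.1 nv.2 w /\ bad nv.1.+1 w.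
  move=> [n v] /=; have [[Sv badv]|nb] := pselect (bad n v); last by exists v.
  apply: contrapT => nw.
  (* If neither letter prolongs the bad prefix, each has its own bound, and the larger of the two
     serves all continuations. *)
  have [N HN] : exists N, forall b w, S w -> agree n v w -> w n = b -> P N w.
    have Nb b : exists N, forall w, S w -> agree n v w -> w n = b -> P N w.
      apply: contrapT => nN; apply: nw.
      have [w [Sw vw wb]] : exists w, [/\ S w, agree n v w & w n = b].
        apply: contra_notP nN => nw; exists 0 => w Sw vw wb.
        by case: nw; exists w.
      exists w => _; split=> //.
      split=> // N; apply: contra_notP nN => nw'; exists N => w' Sw' vw' w'b.
      apply: contra_notP nw' => nPw'; exists w'; split=> //.
      apply: agreeS; last by rewrite wb.
      by apply: agree_trans vw'; apply: agree_sym.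
    have [N1 H1] := Nb true; have [N0 H0] := Nb false.
    exists (maxn N1 N0) => -[] w Sw vw wb.
      by apply: (Pmono N1); rewrite ?leq_maxl //; apply: H1.
    by apply: (Pmono N0); rewrite ?leq_maxr //; apply: H0.
  by have [w [Sw vw]] := badv N; apply; apply: HN vw erefl.
pose v := fix v n := if n is k.+1 then g (k, v k) else v0.
have vbad n : bad n (v n) by elim: n => //= n IH; case: (gP (n, v n) IH).
have vS n : agree n (v n) (v n.+1) by case: (gP (n, v n) (vbad n)).
have vu := agree_limit vS; set u := (fun i => _) in vu.
have Su : S u by apply: Sc => n; exists (v n); [case: (vbad n) | exact: vu].
have [n Pn] := Pex _ Su.
have [_ /(_ n)[w [Sw vw]]] := vbad n; apply.
by apply: Pagree Pn; apply: agree_trans vw; exact: vu.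
Qed.

(** * Coding a closed perfect set by its branchings *)

Section Coding.
Variables (S : set (nat -> bool)) (d : nat -> bool).
Hypotheses (S_closed : seq_closed S) (S_perfect : seq_perfect S).
Implicit Types (u v x y : nat -> bool).

Definition branch u n :=
  `[< forall b, exists v, [/\ S v, agree n u v & v n = b] >].

Lemma branch_agree n u v : agree n u v -> branch u n = branch v n.
Proof.
move=> uv; apply/asboolP/asboolP => uS b; have [w [Sw uw wb]] := uS b;
  exists w; split=> //; apply: agree_trans uw => //; exact: agree_sym.
Qed.

(** When [S] branches at n, this is the place of the letter [u n] in the code of [u]. *)
Definition bidx u n := count (branch u) (iota 0 n).

Lemma bidxS u n : bidx u n.+1 = bidx u n + branch u n.
Proof. by rewrite /bidx -addn1 iotaD count_cat /= addn0. Qed.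

Lemma bidx_agree n u v : agree n u v -> bidx u n = bidx v n.
Proof.
move=> uv; apply: eq_in_count => i; rewrite mem_iota => ni.
exact/branch_agree/(agree_le (ltnW ni)).
Qed.

Lemma bidx_le u n : bidx u n <= n.
Proof. by rewrite -[leqRHS](size_iota 0) count_size. Qed.

Lemma bidx_mono u : {homo bidx u : n k / n <= k}.
Proof.
by apply: homo_leq => [//|? ? ?|n]; [exact: leq_trans | rewrite bidxS leq_addr].
Qed.

Lemma bidx_inj u n k : branch u n -> branch u k -> bidx u n = bidx u k -> n = k.
Proof.
wlog nk : n k / n < k => [H bn bk E|bn bk E].
  by case: (ltngtP n k) => // nk; [exact: H | apply/esym/H].
by have := bidx_mono u nk; rewrite bidxS bn -E addn1 ltnn.
Qed.

Lemma bidx_lt u N j : j < bidx u N -> exists n, [/\ n < N, branch u n & bidx u n = j].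
Proof.
elim: N => [//|N IH]; rewrite bidxS; case: (boolP (branch u N)) => [bN|_].
  rewrite addn1 ltnS leq_eqVlt => /orP[/eqP ->|/IH[n [nN bn nj]]]; first by exists N.
  by exists n; split=> //; apply: ltnW.
by rewrite addn0 => /IH[n [nN bn nj]]; exists n; split=> //; apply: ltnW.
Qed.

(** Perfectness gives another point of [S] with the same first N letters; the first place where it
    differs from [u] is a branching at or after N. *)
Lemma bidx_unbounded u k : S u -> exists N, k <= bidx u N.
Proof.
move=> Su; elim: k => [|k [N kN]]; first by exists 0.
have [v [Sv uv nuv]] := S_perfect N Su.
have ex : exists n, u n != v n.
  by apply: contra_notP nuv => nn; apply/funext => n; apply/eqP; apply: contra_notT nn; exists n.
case: (ex_minnP ex) => n nn nmin; exists n.+1.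
have un : agree n u v.
  by move=> i ni; apply/eqP; apply: contraTT ni => /nmin; rewrite -leqNgt.
have bn : branch u n.
  apply/asboolP => b; have [ub|ub] := eqVneq (u n) b; first by exists u.
  by exists v; split=> //; move: nn ub; case: (u n); case: (v n); case: b.
have Nn : N <= n by rewrite leqNgt; apply: contra nn => nN; rewrite uv.
by rewrite bidxS bn addn1 ltnS (leq_trans kN) // bidx_mono.
Qed.

(** x lists the letters of u at the positions where S branches, relative to d. *)
Definition codes u x := forall n, branch u n -> x (bidx u n) = u n (+) d n.

(** The next letter is read from the code at a branching, and is forced by the preceding letters
    elsewhere. *)
Lemma codes_agree u v x y N : S u -> S v -> codes u x -> codes v y ->
  agree (bidx u N) x y -> agree N u v.
Proof.
move=> Su Sv cx cy; elim: N => [//|N IH] xy.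
have uv : agree N u v by apply: IH; apply: agree_le xy; apply: bidx_mono.
apply: agreeS => //; have [bu|bu] := boolP (branch u N).
  apply: (@addIb (d N)); rewrite -cx // -cy -?(branch_agree uv) //.
  by rewrite (bidx_agree uv) xy // bidxS bu addn1 (bidx_agree uv).
apply: contraNeq bu => nuv; apply/asboolP => b.
have [ub|ub] := eqVneq (u N) b; first by exists u.
by exists v; split=> //; move: nuv ub; case: (u N); case: (v N); case: b.
Qed.

Lemma agree_codes u v x y N : codes u x -> codes v y -> agree N u v ->
  agree (bidx u N) x y.
Proof.
move=> cx cy uv j /bidx_lt[n [nN bn <-]].
have uvn : agree n u v := agree_le (ltnW nN) uv.
by rewrite cx // (bidx_agree uvn) cy -?(branch_agree uvn) // uv.
Qed.

Lemma codes_exists u : S u -> exists x, codes u x.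
Proof.
move=> Su.
have /choice[p pP] : forall j, exists n, branch u n /\ bidx u n = j.
  move=> j; have [N /bidx_lt[n [_ bn nj]]] := bidx_unbounded j.+1 Su.
  by exists n.
exists (fun j => u (p j) (+) d (p j)) => n bn.
have [bp pE] := pP (bidx u n).
by rewrite (bidx_inj bp bn pE).
Qed.

(** From any point of [S], move at each branching to a point with the prescribed letter; the limit
    stays in [S] by closedness. *)
Lemma decodes_exists x : S !=set0 -> exists2 u, S u & codes u x.
Proof.
move=> [v0 Sv0].
have /choice[g gP] : forall nv, exists w, S nv.2 ->
    [/\ S w, agree nv.1 nv.2 w &
        branch nv.2 nv.1 -> w nv.1 = x (bidx nv.2 nv.1) (+) d nv.1].
  move=> [n v] /=; have [/asboolP bv|nb] := boolP (branch v n); last by exists v.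
  by have [w [Sw vw wb]] := bv (x (bidx v n) (+) d n); exists w.
pose v := fix v n := if n is k.+1 then g (k, v k) else v0.
have Sv n : S (v n) by elim: n => //= n IH; case: (gP (n, v n) IH).
have vS n : agree n (v n) (v n.+1) by case: (gP (n, v n) (Sv n)).
have vu := agree_limit vS; set u := (fun i => _) in vu.
exists u => [|n]; first by apply: S_closed => n; exists (v n).
rewrite (branch_agree (vu n)) (bidx_agree (vu n)) => bn.
have [_ _ /(_ bn) /= E] := gP (n, v n) (Sv n).
by rewrite /u /= E addbK.
Qed.

(** Compactness makes the growth of the code uniform, whence the uniform continuity of the coding
    map. *)
Lemma bidx_unif k : exists N, forall u, S u -> k <= bidx u N.
Proof.
apply: (konig (P := fun N u => k <= bidx u N)) => //.
- by move=> n k' u nk kn; apply: leq_trans kn _; apply: bidx_mono.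
- by move=> n u v uv; rewrite (bidx_agree uv).
- by move=> u; apply: bidx_unbounded.
Qed.

Lemma cantor_coding : S !=set0 -> exists f g : (nat -> bool) -> nat -> bool,
  [/\ forall u, S u -> codes u (f u),
      forall x, S (g x) /\ codes (g x) x,
      unif_cont S f & unif_cont setT g].
Proof.
move=> S0.
have /choice[f fP] : forall u, exists x, S u -> codes u x.
  move=> u; have [/codes_exists[x cx]|nu] := pselect (S u); first by exists x.
  by exists u.
have /choice[g gP] : forall x, exists u, S u /\ codes u x.
  by move=> x; have [u Su cu] := decodes_exists x S0; exists u.
exists f, g; split=> // [k|k]; last first.
  (* The first k letters of a point use at most k letters of its code. *)
  exists k => x y _ _ xy; apply: codes_agree (agree_le (bidx_le _ _) xy); by apply gP.
have [N HN] := bidx_unif k; exists N => u v Su Sv uv.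
by apply: agree_le (HN _ Su) _; apply: agree_codes uv; exact: fP.
Qed.

End Coding.

(** The two marked points will be the intersections with the line; they also make [S] nonempty. *)
Record pointed_cantor (S : set (nat -> bool)) (c : nat -> bool) := PointedCantor {
  pcantor_closed : seq_closed S;
  pcantor_perfect : seq_perfect S;
  pcantor_bcons : forall b, S (bcons b c)
}.

Lemma cantor_chart S c : pointed_cantor S c ->
  exists f g : (nat -> bool) -> nat -> bool,
  [/\ forall u, S u -> g (f u) = u,
      forall x, S (g x) /\ f (g x) = x,
      forall b, f (bcons b c) = bcons b (fun=> false),
      unif_cont S f & unif_cont setT g].
Proof.
(* Codes are taken relative to [0c]. Position 0 branches, as [0c] and [1c] are both in [S], so [bc]
   has code letter b there; it agrees with [d] afterwards, so the other code letters are [false]. *)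
move=> [Sc Sp Sb]; pose d := bcons false c.
have S0 : S !=set0 by exists (bcons true c).
have [f [g [fP gP fu gu]]] := cantor_coding d Sc Sp S0.
have code_inj u x y : S u -> codes S d u x -> codes S d u y -> x = y.
  move=> Su cx cy; apply/funext => i; have [N iN] := bidx_unbounded Sp i.+1 Su.
  by apply: (agree_codes cx cy (N := N)).
exists f, g; split=> //.
- move=> u Su; have [Sg cg] := gP (f u); apply/funext => i.
  by apply: (codes_agree Sg Su cg (fP _ Su) (N := i.+1)).
- move=> x; have [Sg cg] := gP x; split=> //; exact: code_inj (fP _ Sg) cg.
- move=> b; apply: (code_inj (bcons b c)) => //; first exact: fP.
  move=> [_|n bn]; first by rewrite /bidx /=; case: (b).
  suff -> : bidx S (bcons b c) n.+1 = (bidx S (bcons b c) n.+1).-1.+1 by rewrite /= addbb.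
  rewrite prednK // (leq_trans _ (bidx_mono S (bcons b c) (ltn0Sn n))) // bidxS.
  suff -> : branch S (bcons b c) 0 by rewrite addn1.
  by apply/asboolP => b'; exists (bcons b' c).
Qed.

(** Both charts send the marked points to the same two sequences b000..., so one chart followed by
    the inverse of the other matches them. *)
Lemma cantor_pair_homeo S c S' c' : pointed_cantor S c -> pointed_cantor S' c' ->
  exists f g : (nat -> bool) -> nat -> bool,
  [/\ forall u, S u -> S' (f u) /\ g (f u) = u,
      forall u, S' u -> S (g u) /\ f (g u) = u,
      forall b, f (bcons b c) = bcons b c' /\ g (bcons b c') = bcons b c,
      unif_cont S f & unif_cont S' g].
Proof.
move=> Sc Sc'.
have [f [g [fK gK fb fu gu]]] := cantor_chart Sc.
have [f' [g' [f'K g'K f'b f'u g'u]]] := cantor_chart Sc'.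
exists (g' \o f), (g \o f'); split=> /=.
- by move=> u Su; have [Su' ->] := g'K (f u); rewrite fK.
- by move=> u Su; have [Su' ->] := gK (f' u); rewrite f'K.
- move=> b; rewrite fb f'b -{1}f'b -[X in g X]fb.
  by rewrite f'K ?fK //; exact: pcantor_bcons.
- move=> k; have [N HN] := g'u k; have [M HM] := fu N.
  by exists M => u v Su Sv uv; apply: HN => //; apply: HM.
- move=> k; have [N HN] := gu k; have [M HM] := f'u N.
  by exists M => u v Su Sv uv; apply: HN => //; apply: HM.
Qed.

Import GRing.Theory.
Local Open Scope ring_scope.

Local Notation proj := Defs.proj.

(** * Point modules and words *)

Lemma malgUM (M : monomType) (R : nzRingType) (c d : R) (u v : M) :
  << c *g u >> * << d *g v >> = << c * d *g mmul u v >> :> {malg R[M]}.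
Proof. by rewrite malgM_def fgmulUU. Qed.

Lemma malgUZ (M : choiceType) (R : nzRingType) (c : R) (w : M) :
  << c *g w >> = c *: << w >> :> {malg R[M]}.
Proof.
apply/malgP => k; rewrite mcoeffZ !mcoeffU.
by case: eqP => _; rewrite ?mulr1n ?mulr1 ?mulr0n ?mulr0.
Qed.

(** Expressing each family in the other gives matrices with product the identity of size n that
    factors through size k. *)
Lemma has_dim_le (K : fieldType) (V : lmodType K) (S : set V) n k :
  has_dim S n -> has_dim S k -> (n <= k)%N.
Proof.
move=> [b [Sb indb]] [b' [Sb' _]].
have inS T (N : nat) (e : 'I_N -> V) :
    (forall v, T v <-> exists c : 'I_N -> K, v = \sum_i c i *: e i) ->
    forall i, T (e i).
  move=> Te i; apply/Te; exists (fun j => (j == i)%:R).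
  rewrite (bigD1 i) //= eqxx scale1r big1 ?addr0 // => j /negbTE ->.
  by rewrite scale0r.
have /choice[M HM] : forall i, exists c : 'I_k -> K,
    b i = \sum_j c j *: b' j by move=> i; apply/Sb'; exact: (inS S).
have /choice[N HN] : forall i, exists c : 'I_n -> K,
    b' i = \sum_j c j *: b j by move=> i; apply/Sb; exact: (inS S).
pose P := \matrix_(i, j) M i j; pose Q := \matrix_(i, j) N i j.
apply: (@mulmx1_min _ _ _ P Q); apply/matrixP => i l.
have : \sum_l ((P *m Q) i l - (i == l)%:R) *: b l = 0.
  under eq_bigr do rewrite scalerBl.
  rewrite sumrB; apply/eqP; rewrite subr_eq0; apply/eqP.
  rewrite [RHS](bigD1 i) //= eqxx scale1r [X in _ = _ + X]big1 ?addr0; last first.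
    by move=> j ji; rewrite eq_sym (negbTE ji) scale0r.
  rewrite HM; under [RHS]eq_bigr do rewrite HN scaler_sumr.
  rewrite exchange_big /=; apply: eq_bigr => j _.
  rewrite mxE scaler_suml; apply: eq_bigr => t _.
  by rewrite !mxE scalerA.
by move/indb/(_ l)/eqP; rewrite subr_eq0 mxE => /eqP ->; rewrite !mxE.
Qed.

Lemma has_dim_uniq (K : fieldType) (V : lmodType K) (S : set V) n k :
  has_dim S n -> has_dim S k -> n = k.
Proof. by move=> Sn Sk; apply/eqP; rewrite eqn_leq !(has_dim_le (S := S)). Qed.

Section MonomialAlgebra.
Variables (F : fieldType) (A : monomial_algebra F).
Local Notation m := (ngen A).

Definition wordval (s : seq 'I_m) : A := pres A << FMonom s >>.

Lemma wordval_cat s t : wordval (s ++ t) = wordval s * wordval t.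
Proof. by rewrite /wordval -rmorphM /= malgUM mulr1 -[mmul _ _]/(fmmul _ _) fmmulE. Qed.

Lemma wordval_nil : wordval [::] = 1.
Proof. by rewrite /wordval -fmoneE rmorph1. Qed.

Lemma wordval1 j : wordval [:: j] = var j.
Proof. by rewrite /wordval /var fmuE. Qed.

Lemma presZ c p : pres A (c *: p) = c *: pres A p.
Proof. exact: linearZ. Qed.

Lemma presU c w : pres A << c *g w >> = c *: pres A << w >>.
Proof. by rewrite malgUZ presZ. Qed.

Lemma presE p : pres A p = \sum_(w <- msupp p) p@_w *: wordval w.
Proof.
rewrite {1}[p]monalgE raddf_sum; apply: eq_bigr => w _.
by rewrite /wordval fmK; exact: presU.
Qed.

(** An ideal generated by words is spanned by words: a word containing a relation is zero in [A],
    and any other word has coefficient 0 in every [a i * b i * c i]. *)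
Lemma pres_eq0 p : pres A p = 0 -> forall w, p@_w != 0 -> wordval w = 0.
Proof.
move=> /pres_ker[n [a [b [c [Sb ->]]]]] w; rewrite raddf_sum /=.
have [[r [u [v [Rr wE]]]] _|nJ] :=
    pselect (exists r u v, @rels F A r /\ w = mmul (mmul u r) v).
  rewrite /wordval fmK; apply/pres_ker.
  exists 1%N, (fun=> << u >>), (fun=> << r >>), (fun=> << v >>).
  by split=> [_|]; [exists r | rewrite big_ord1 !malgUM !mulr1 wE].
case/eqP; rewrite big1 // => i _; have [r Rr rE] := Sb i.
apply/mcoeff_outdom/negP => /msuppM_le[k [v [/msuppM_le[u [r' [_]]]]]].
rewrite -rE msuppU1 inE => /eqP -> -> _ wE.
by apply: nJ; exists r, u, v.
Qed.

(** The nonzero words of length n form a basis, independent by [pres_eq0]. The renaming [o] makes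
    the count available for boolean words. *)
Lemma homog_comp_dim (T : finType) (o : T -> 'I_m) n : bijective o ->
  has_dim (homog_comp A n) #|[pred t : n.-tuple T | wordval (map o t) != 0]|.
Proof.
move=> [o' oK o'K]; set W := [pred t | _].
pose wd (t : n.-tuple T) := FMonom (map o t).
have wd_inj : injective wd.
  by move=> s t [] /(inj_map (can_inj oK)) /val_inj.
have wdE (t : n.-tuple T) : wordval (map o t) = pres A << wd t >> by [].
pose b (i : 'I_#|W|) := wordval (map o (enum_val i : n.-tuple T)).
have bE c : \sum_i c i *: b i = pres A (\sum_i << c i *g wd (enum_val i) >>).
  rewrite raddf_sum; apply: eq_bigr => i _.
  by rewrite /b wdE; exact: (esym (presU _ _)).
exists b; split=> [v|c]; last first.
  rewrite bE => /pres_eq0 c0 i; apply/eqP; apply: contraT => ci0.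
  have := enum_valP i; rewrite inE -[map _ _]/(wd _ : seq _) c0 ?eqxx //.
  rewrite raddf_sum /= (bigD1 i) //= mcoeffUU big1 ?addr0 // => j ji.
  rewrite mcoeffU; case: eqP => // /wd_inj /enum_val_inj jiE.
  by rewrite jiE eqxx in ji.
split=> [[p pn <-]|[c ->]]; last first.
  rewrite bE; eexists; last by [].
  move=> w; rewrite -mcoeff_neq0 raddf_sum /= => /eqP nz.
  have [i /eqP wE] : exists i : 'I_#|W|, wd (enum_val i) == w.
    apply/existsP; apply: contra_notT nz => /existsPn nE.
    by rewrite big1 // => i _; rewrite mcoeffU (negbTE (nE i)).
  by rewrite -wE fdegE /= size_map size_tuple.
exists (fun i => p@_(wd (enum_val i))).
rewrite -(big_enum_val (A := W) (fun t => p@_(wd t) *: wordval (map o t))) /=.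
rewrite big_mkcond /=.
transitivity (\sum_t pres A << p@_(wd t) *g wd t >>); last first.
  apply: eq_bigr => t _; rewrite presU inE -wdE.
  by case: eqP => // ->; rewrite scaler0.
rewrite -raddf_sum; congr (pres A _); apply/malgP => k.
rewrite raddf_sum /=.
have [kn|kn] := eqVneq (size k) n.
  have sz : size (map o' k) == n by rewrite size_map kn.
  have kE : wd (Tuple sz) = k.
    by rewrite /wd /= -map_comp (eq_map o'K) map_id fmK.
  rewrite (bigD1 (Tuple sz)) //= kE mcoeffUU big1 ?addr0 // => t tn.
  rewrite mcoeffU; case: eqP => //; rewrite -{1}kE => /wd_inj tE.
  by rewrite tE eqxx in tn.
rewrite mcoeff_outdom; last by apply: contra kn => /pn/eqP.
rewrite big1 // => t _; rewrite mcoeffU; case: eqP => // tk.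
by case/eqP: kn; rewrite -tk /= size_map size_tuple.
Qed.

(** Each factor [1 - 'X] takes differences of coefficients, so $h_{n+2} = 2h_{n+1} - h_n$ with $h_0
    = 1$ and $h_1 = 2$. *)
Lemma hilbert_series_P1_dim : hilbert_series_P1 A ->
  forall n, has_dim (homog_comp A n) n.+1.
Proof.
move=> [h [hdim hser]]; suff hn n : h n = n.+1 by move=> n; rewrite -hn.
elim/ltn_ind: n => n IH.
(* Only the coefficients up to n enter, so the truncated series is replaced by any [q] that has
   them. *)
suff key (q : {poly int}) : (forall k, (k <= n)%N -> q`_k = (h k)%:Z) ->
    (q * (1 - 'X) ^+ 2)`_n = (n == 0%N)%:R -> h n = n.+1.
  by apply: key (hser n) => k kn; rewrite coef_poly ltnS kn.
have coefM0 (p : {poly int}) : (p * (1 - 'X))`_0 = p`_0.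
  by rewrite mulrBr mulr1 coefB coefMX subr0.
have coefMS (p : {poly int}) k : (p * (1 - 'X))`_k.+1 = p`_k.+1 - p`_k.
  by rewrite mulrBr mulr1 coefB coefMX.
rewrite expr2 mulrA.
case: n IH => [|[|n]] IH qE; rewrite ?(coefMS, coefM0).
- by rewrite qE // => -[].
- rewrite !qE // (IH 0%N) //; lia.
by rewrite (qE n.+2) // (qE n.+1) // (qE n) ?(IH n.+1) ?(IH n) //; lia.
Qed.


(** No generator is zero, so every letter counts in degree 1, where the dimension is 2. *)
Lemma ngen_P1 : hilbert_series_P1 A -> m = 2%N.
Proof.
move=> /hilbert_series_P1_dim/(_ 1%N) dim2.
have id_bij : bijective (id : 'I_m -> 'I_m) by exists id.
rewrite (has_dim_uniq dim2 (homog_comp_dim 1 id_bij)) -[LHS]card_ord -[LHS]expn1.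
rewrite -card_tuple; apply: eq_card => t; rewrite !inE; apply/esym.
case/tupleP: t => j t; rewrite tuple0 /= wordval1; exact: pres_gen_neq0.
Qed.

(** Words span [A]; if every [u ++ w ++ v] were zero, then [u A v] would vanish. *)
Lemma prime_wordval u v : prime_ring A -> wordval u != 0 -> wordval v != 0 ->
  exists w, wordval (u ++ w ++ v) != 0.
Proof.
move=> prA u0 v0; apply: contrapT => nw.
have [r|/eqP|/eqP] := prA (wordval u) (wordval v); last 2 first.
- by rewrite (negbTE u0).
- by rewrite (negbTE v0).
have [p <-] := pres_surj r; rewrite presE mulr_sumr mulr_suml.
rewrite big1 // => w _; rewrite -scalerAr -scalerAl -mulrA -!wordval_cat.
have [->|nz] := eqVneq (wordval (u ++ w ++ v)) 0; first by rewrite scaler0.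
by case: nw; exists w.
Qed.

End MonomialAlgebra.

Section WordCoef.
Variables (K : fieldType) (m : nat).
Implicit Types (f g : nat -> 'I_m -> K) (s : seq 'I_m).

(** If $e_i x_j = f_{ij} e_{i+1}$, this is the scalar with which the word [s] takes $e_i$ to
    $e_{i+|s|}$. *)
Fixpoint wcoef f (i : nat) s : K :=
  if s is j :: s' then f i j * wcoef f i.+1 s' else 1.

Lemma wcoef_cat f i s t :
  wcoef f i (s ++ t) = wcoef f i s * wcoef f (i + size s) t.
Proof.
elim: s i => [|j s IH] i /=; first by rewrite mul1r addn0.
by rewrite IH mulrA addSnnS.
Qed.

Lemma wcoef_sub f g : (forall i j, f i j != 0 -> g i j != 0) ->
  forall i s, wcoef f i s != 0 -> wcoef g i s != 0.
Proof.
move=> fg i s; elim: s i => [//|j s IH] i /=; rewrite !mulf_eq0 !negb_or.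
by move=> /andP[/fg -> /IH ->].
Qed.

Lemma wcoef_neq0_ex f : (forall i, exists j, f i j != 0) ->
  forall i n, exists2 s, size s = n & wcoef f i s != 0.
Proof.
move=> fn0 i n; elim: n i => [|n IH] i; first by exists [::]; rewrite ?oner_eq0.
have [j fj] := fn0 i; have [s sn fs] := IH i.+1.
by exists (j :: s) => /=; rewrite ?sn // mulf_neq0.
Qed.

End WordCoef.

Section ProjPoint.
Variables (K : fieldType) (m : nat).

Definition pcoord (x : proj K m) (j : 'I_m) : K := vpick (val x) 0 j.

Lemma proj_vpick (x : proj K m) : val x = <[vpick (val x)]>%VS.
Proof.
apply/eqP; rewrite eq_sym eqEdim -memvE memv_pick (eqP (valP x)) dim_vline.
by rewrite vpick0 -dimv_eq0 (eqP (valP x)).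
Qed.

Lemma pcoord_neq0 (x : proj K m) : exists j, pcoord x j != 0.
Proof.
apply: contrapT => n0; have : vpick (val x) == 0.
  apply/eqP/rowP => j; rewrite mxE; apply/eqP; apply: contraT => j0.
  by case: n0; exists j.
by rewrite vpick0 -dimv_eq0 (eqP (valP x)).
Qed.

End ProjPoint.

Section PointModuleWords.
Variables (F : fieldType) (A : monomial_algebra F).
Variables (K : fieldType) (iota : {rmorphism F -> K}).
Local Notation m := (ngen A).
Implicit Types (l : pseq K m) (p q : {malg F[{fmonom 'I_m}]}) (v : {poly K}).

(** A word acts on $e_i$ by its coefficient; a word that is zero in [A] acts by 0, while $e_{i+|s|}$
    is nonzero. *)
Lemma limP_wcoef l : limP A iota l ->
  forall i s, wcoef (fun i => pcoord (l i)) i s != 0 -> wordval s != 0.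
Proof.
move=> [P [e [c [eP ce lc]]]] i s ls.
have actw j t : ract (e j) (wordval t) = wcoef (fun i => c i 0) j t *: e (j + size t)%N.
  elim: t j => [|k t IH] j /=; first by rewrite wordval_nil ract1 scale1r addn0.
  rewrite -cat1s wordval_cat ractM wordval1 ce ractZl IH scalerA.
  by rewrite addSnnS.
have : wcoef (fun i => c i 0) i s != 0.
  (* The chosen generator of the line [l i] is a multiple of [c i], hence vanishes wherever [c i]
     does. *)
  apply: wcoef_sub ls => {}i j; apply: contra_neq => cij.
  have : vpick (val (l i)) \in <[c i]>%VS by rewrite -lc memv_pick.
  by case/vlineP => k; rewrite /pcoord => ->; rewrite mxE cij mulr0.
apply: contra_neq => s0; have := actw i s.
rewrite s0 -(scale0r 0) ractZr rmorph0 scale0r => /esym/eqP.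
by rewrite scaler_eq0 => /orP[/eqP //|/eqP /(proj2 (eP _))].
Qed.

Section Construction.
Variable l : pseq K m.
Hypothesis l_words :
  forall i s, wcoef (fun i => pcoord (l i)) i s != 0 -> wordval s != 0.
Local Notation f := (fun i => pcoord (l i)).

(** The action on the basis vector e_i = X^i of K[X]. *)
Definition bact (i : nat) p : {poly K} :=
  mmap (polyC \o iota) (fun w : {fmonom 'I_m} => wcoef f i w *: 'X^(i + size w)) p.

Lemma bactU i c w : bact i << c *g w >> = (iota c * wcoef f i w) *: 'X^(i + size w).
Proof. by rewrite /bact mmapU /= mul_polyC scalerA. Qed.

Lemma bactE i p :
  bact i p = \sum_(w <- msupp p) (iota p@_w * wcoef f i w) *: 'X^(i + size w).
Proof. by rewrite /bact mmapE; apply: eq_bigr => w _; rewrite /= mul_polyC scalerA. Qed.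

Lemma bactD i p q : bact i (p + q) = bact i p + bact i q.
Proof. exact: mmapD. Qed.

Lemma bactZ i c p : bact i (c *: p) = iota c *: bact i p.
Proof.
transitivity (\sum_(w <- msupp p) (polyC \o iota) (c *: p)@_w *
    (wcoef f i w *: 'X^(i + size w))); first exact: (mmapEw (msuppZ_le c p)).
rewrite bactE scaler_sumr; apply: eq_bigr => w _.
have -> : (c *: p)@_w = c * p@_w by exact: mcoeffZ.
by rewrite /= mul_polyC rmorphM !scalerA mulrA.
Qed.

(** This lets the action descend to [A]: each word in the support of [p] is zero in [A], so
    [l_words] makes its coefficient 0. *)
Lemma bact_pres0 i p : pres A p = 0 -> bact i p = 0.
Proof.
move=> /pres_eq0 p0; rewrite bactE big1_seq // => w /= wp.
have := p0 w; rewrite mcoeff_neq0 => /(_ wp) w0.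
have [->|/l_words] := eqVneq (wcoef f i w) 0; first by rewrite mulr0 scale0r.
by rewrite /= w0 eqxx.
Qed.

Definition pact v p : {poly K} := \sum_(i < size v) v`_i *: bact i p.

Lemma pactE n v p : (size v <= n)%N -> pact v p = \sum_(i < n) v`_i *: bact i p.
Proof.
move=> vn; rewrite /pact (big_ord_widen n (fun i => v`_i *: bact i p)) //.
rewrite big_mkcond; apply: eq_bigr => i _; case: ltnP => // vi.
by rewrite nth_default // scale0r.
Qed.

Lemma pactDl v w p : pact (v + w) p = pact v p + pact w p.
Proof.
rewrite !(@pactE (maxn (size v) (size w))) ?leq_maxl ?leq_maxr ?size_polyD //.
by rewrite -big_split; apply: eq_bigr => i _; rewrite coefD scalerDl.
Qed.

Lemma pactZl c v p : pact (c *: v) p = c *: pact v p.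
Proof.
rewrite (@pactE (size v)) ?size_scale_leq // scaler_sumr.
by apply: eq_bigr => i _; rewrite coefZ scalerA.
Qed.

Lemma pactDr v p q : pact v (p + q) = pact v p + pact v q.
Proof. by rewrite -big_split; apply: eq_bigr => i _; rewrite bactD scalerDr. Qed.

Lemma pactZr c v p : pact v (c *: p) = iota c *: pact v p.
Proof.
rewrite scaler_sumr; apply: eq_bigr => i _.
by rewrite bactZ !scalerA mulrC.
Qed.

Lemma pactX i p : pact 'X^i p = bact i p.
Proof.
rewrite /pact size_polyXn big_ord_recr /= coefXn eqxx scale1r big1 ?add0r // => j _.
by rewrite coefXn ltn_eqF // scale0r.
Qed.

Lemma pact_sum (I : Type) (r : seq I) (E : I -> {poly K}) p :
  pact (\sum_(i <- r) E i) p = \sum_(i <- r) pact (E i) p.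
Proof.
elim: r => [|i r IH]; last by rewrite !big_cons pactDl IH.
by rewrite !big_nil /pact size_poly0 big_ord0.
Qed.

Lemma pact1 v : pact v 1 = v.
Proof.
rewrite -[RHS]coefK poly_def; apply: eq_bigr => i _.
rewrite (_ : 1 = << FMonom [::] >>); last by rewrite -fmoneE.
by rewrite bactU rmorph1 mul1r addn0 scale1r.
Qed.

Lemma pactM v p q : pact v (p * q) = pact (pact v p) q.
Proof.
rewrite [LHS]/pact [pact v p]/pact pact_sum; apply: eq_bigr => i _; rewrite pactZl.
congr (_ *: _); rewrite [in RHS]bactE pact_sum malgME /bact raddf_sum.
apply: eq_bigr => u _; rewrite pactZl pactX bactE raddf_sum scaler_sumr.
apply: eq_bigr => w _; etransitivity; first exact: (bactU i _ (mmul u w)).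
rewrite -[mmul u w]/(fmmul u w) fmmulE /= wcoef_cat size_cat rmorphM scalerA addnA; congr (_ *: _).
by rewrite mulrACA.
Qed.

Lemma pact_pres0 v p : pres A p = 0 -> pact v p = 0.
Proof. by move=> p0; rewrite /pact big1 // => i _; rewrite bact_pres0 ?scaler0. Qed.

Lemma pact_pres v p q : pres A p = pres A q -> pact v p = pact v q.
Proof.
move=> pq; rewrite -[p](subrK q) pactDr pact_pres0 ?add0r //.
by rewrite raddfB /= pq subrr.
Qed.

Definition lact v (a : A) : {poly K} := pact v (projT1 (cid (pres_surj a))).

Lemma lactE v p : lact v (pres A p) = pact v p.
Proof. by rewrite /lact; case: cid => q /= /(pact_pres v). Qed.

Lemma lactDl v w a : lact (v + w) a = lact v a + lact w a.
Proof. exact: pactDl. Qed.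

Lemma lactDr v a b : lact v (a + b) = lact v a + lact v b.
Proof.
have [p <-] := pres_surj a; have [q <-] := pres_surj b.
by rewrite -raddfD !lactE pactDr.
Qed.

Lemma lactZl c v a : lact (c *: v) a = c *: lact v a.
Proof. exact: pactZl. Qed.

Lemma lactZr c v a : lact v (c *: a) = iota c *: lact v a.
Proof. by have [p <-] := pres_surj a; rewrite -presZ !lactE pactZr. Qed.

Lemma lact1 v : lact v 1 = v.
Proof. by rewrite -(rmorph1 (pres A)) lactE pact1. Qed.

Lemma lactM v a b : lact v (a * b) = lact (lact v a) b.
Proof.
have [p <-] := pres_surj a; have [q <-] := pres_surj b.
by rewrite -rmorphM !lactE pactM.
Qed.

Definition poly_module : right_module A iota :=
  @RightModule F A K iota {poly K} lact lactDl lactDr lactZl lactZr lact1 lactM.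

Definition poly_comp (n : nat) : set poly_module := [set c *: 'X^n | c in [set: K]].

Lemma lactX_wordval i s : lact 'X^i (wordval s) = wcoef f i s *: 'X^(i + size s).
Proof. by rewrite /wordval lactE pactX bactU rmorph1 mul1r. Qed.

Lemma poly_comp_dim1 n : has_dim (@poly_comp n) 1.
Proof.
exists (fun=> 'X^n); split=> [v|c /eqP].
  split=> [[c _ <-]|[c ->]]; first by exists (fun=> c); rewrite big_ord1.
  by rewrite big_ord1; exists (c ord0).
rewrite big_ord1 scaler_eq0 -size_poly_eq0 size_polyXn orbF => /eqP c0 i.
by rewrite (ord1 i).
Qed.

Lemma poly_comp_span (v : poly_module) : exists (n : nat) (w : nat -> poly_module),
  (forall i, poly_comp i (w i)) /\ v = \sum_(i < n) w i.
Proof.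
exists (size (v : {poly K})), (fun i => (v : {poly K})`_i *: 'X^i).
by split=> [i|]; [exists (v : {poly K})`_i | rewrite -poly_def coefK].
Qed.

Lemma poly_comp_direct (n : nat) (w : nat -> poly_module) :
  (forall i, poly_comp i (w i)) -> \sum_(i < n) w i = 0 ->
  forall i, (i < n)%N -> w i = 0.
Proof.
move=> /(_ _)/cid2-/all_sig2[c _ wE] s0 i iN; rewrite -wE.
suff -> : c i = 0 by rewrite scale0r.
have /(congr1 (fun v : {poly K} => v`_i)) := s0.
under eq_bigr do rewrite -wE.
rewrite coef0 coef_sum (bigD1 (Ordinal iN)) //= coefZ coefXn eqxx mulr1.
rewrite big1 ?addr0 // => j ji; rewrite coefZ coefXn; case: eqP => [ij|]; last by rewrite mulr0.
by case/eqP: ji; apply/val_inj.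
Qed.

Lemma poly_comp_graded i n (v : poly_module) (a : A) :
  poly_comp i v -> homog_comp A n a -> poly_comp (i + n) (ract v a).
Proof.
move=> [c _ <-] [p pn <-]; rewrite /= lactZl lactE pactX bactE.
exists (c * \sum_(w <- msupp p) (iota p@_w * wcoef f i w)) => //.
rewrite -scalerA scaler_suml; congr (_ *: _); apply: eq_big_seq => w wp.
by rewrite -(pn w wp) fdegE.
Qed.

(** Every point of projective space has a nonzero coordinate, so some word of length k takes 1 to a
    nonzero multiple of ['X^k]. *)
Lemma poly_comp_cyclic : exists2 e0 : poly_module, poly_comp 0 e0 &
  forall v : poly_module, exists (n : nat) (c : 'I_n -> K) (a : 'I_n -> A),
    v = \sum_k c k *: ract e0 (a k).
Proof.
exists ('X^0 : {poly K}); first by exists 1; rewrite ?scale1r.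
move=> v; have /(_ 0%N) := wcoef_neq0_ex (fun i => pcoord_neq0 (l i)).
move=> /(_ _)/cid2-/all_sig2[s sz sn0].
exists (size (v : {poly K})), (fun k => (v : {poly K})`_k / wcoef f 0 (s k)).
exists (fun k => wordval (s k)).
rewrite -[LHS](coefK (v : {poly K})) poly_def; apply: eq_bigr => k _.
by rewrite /= lactX_wordval scalerA divfK ?sn0 // add0n sz.
Qed.

Definition poly_point_module : point_module A iota :=
  @PointModule F A K iota poly_module poly_comp poly_comp_dim1 poly_comp_span
    poly_comp_direct poly_comp_graded poly_comp_cyclic.

Lemma limP_of_wcoef : limP A iota l.
Proof.
exists poly_point_module, (fun i => 'X^i : {poly K}), (fun i => vpick (val (l i))).
split=> [i|i j|i]; last exact: proj_vpick.
  split; first by exists 1; rewrite ?scale1r.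
  by move/eqP; rewrite -size_poly_eq0 size_polyXn.
by rewrite -wordval1 /= lactX_wordval /= mulr1 addn1.
Qed.

End Construction.

Lemma limPE l : limP A iota l <->
  forall i s, wcoef (fun i => pcoord (l i)) i s != 0 -> wordval s != 0.
Proof. by split; [exact: limP_wcoef | exact: limP_of_wcoef]. Qed.

End PointModuleWords.

(** * The pro-variety of a pointed Cantor set *)

Definition bord (b : bool) : 'I_2 := if b then ord_max else ord0.

Lemma bord_surj (j : 'I_2) : exists b, j = bord b.
Proof. by case: j => [[|[|//]] j2]; [exists false|exists true]; apply/val_inj. Qed.

Lemma bord_inj : injective bord.
Proof. by move=> [] []. Qed.

(** * Coordinate points of the projective line and sequences of them *)

Section CoordinatePoints.
Variable K : fieldType.
Implicit Types (x z : proj K 2) (b : bool) (u c : nat -> bool).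

Let evec b : 'rV[K]_2 := delta_mx 0 (bord b).

Fact ept_subproof b : \dim <[evec b]>%VS == 1%N.
Proof.
rewrite dim_vline; suff -> : evec b != 0 by [].
apply/eqP => /rowP/(_ (bord b))/eqP; rewrite !mxE !eqxx /=.
by rewrite oner_eq0.
Qed.

Definition ept b : proj K 2 :=
  exist (fun U : {vspace 'rV[K]_2} => \dim U == 1%N) <[evec b]>%VS (ept_subproof b).

Lemma pcoord_ept b b' : (pcoord (ept b) (bord b') != 0) = (b == b').
Proof.
have E (j : 'I_2) : j != bord b -> pcoord (ept b) j = 0.
  have : vpick (val (ept b)) \in <[evec b]>%VS by exact: memv_pick.
  by case/vlineP => k; rewrite /pcoord => -> /negPf jb; rewrite !mxE jb andbF mulr0.
have [<-|nb] := eqVneq b b'; last first.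
  by rewrite E ?eqxx //; apply: contra nb => /eqP/bord_inj ->.
have [j j0] := pcoord_neq0 (ept b); suff <- : j = bord b by [].
by apply/eqP; apply: contraNT j0 => /E ->.
Qed.

Lemma ept_inj : injective ept.
Proof.
move=> b b' E; apply/eqP; rewrite -pcoord_ept E pcoord_ept; exact/eqP.
Qed.

Lemma ept_eq x b : pcoord x (bord (~~ b)) = 0 -> x = ept b.
Proof.
move=> x0; apply/val_inj => /=; rewrite proj_vpick.
apply/eqP; rewrite eqEdim (eqP (ept_subproof b)) -proj_vpick (eqP (valP x)) leqnn.
rewrite andbT proj_vpick -memvE.
suff -> : vpick (val x) = pcoord x (bord b) *: delta_mx 0 (bord b).
  by rewrite memvZ ?memv_line.
apply/rowP => j; have [b' ->] := bord_surj j; rewrite !mxE eqxx /=.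
have [->|bb'] := eqVneq b' b; first by rewrite eqxx mulr1.
move: bb' x0; rewrite /pcoord /= => bb' x0.
by rewrite (inj_eq bord_inj) (negPf bb') mulr0 -x0; case: b b' bb' {x0} => [] [].
Qed.

Definition pt u : pseq K 2 := fun i => ept (u i).

Definition line c z : pseq K 2 := fun i => if i is k.+1 then ept (c k) else z.

Lemma pt_inj : injective pt.
Proof. by move=> u v uv; apply/funext => i; apply/ept_inj/(congr1 (@^~ i) uv). Qed.

Lemma line_ept c b : line c (ept b) = pt (bcons b c).
Proof. by apply/funext => -[]. Qed.

Lemma trunc_agree m n (l l' : pseq K m) :
  trunc n l = trunc n l' <-> forall i, (i < n.+1)%N -> l i = l' i.
Proof.
split=> [E i ni|E]; last by apply/ffunP => i; rewrite !ffunE E.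
by have /ffunP/(_ (Ordinal ni)) := E; rewrite !ffunE.
Qed.

Lemma trunc_eq m (l l' : pseq K m) : (forall n, trunc n l = trunc n l') -> l = l'.
Proof. by move=> E; apply/funext => i; have /trunc_agree -> := E i. Qed.

Lemma trunc_pt n u v : trunc n (pt u) = trunc n (pt v) <-> agree n.+1 u v.
Proof.
rewrite trunc_agree; split=> E i /E; first exact: ept_inj.
by rewrite /pt => ->.
Qed.

Lemma drop_last_trunc m n (l : pseq K m) : drop_last (trunc n.+1 l) = trunc n l.
Proof. by apply/ffunP => i; rewrite !ffunE. Qed.

Lemma hcoord_pt n u (i : 'I_n.+1) b :
  (hcoord (trunc n (pt u)) i (bord b) != 0) = (u i == b).
Proof. by rewrite /hcoord ffunE; exact: pcoord_ept. Qed.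

Lemma hcoord_line n c z (i : 'I_n.+1) b : (0 < i)%N ->
  (hcoord (trunc n (line c z)) i (bord b) != 0) = (bcons false c i == b).
Proof.
by rewrite /hcoord ffunE; case: (i : nat) => // k _; exact: pcoord_ept.
Qed.

End CoordinatePoints.

(** * Monomials in the coordinates and regular maps *)

Section Monomials.
Variables (F : fieldType) (r m : nat).
Implicit Types (s : seq ('I_r * 'I_m)).

Definition cmon s : {cmonom ('I_r * 'I_m)%type} :=
  foldr (fun p w => mulcm (ucm p) w) (onecm _) s.

Definition mon s : mpol F r m := << cmon s >>.

Lemma mon_multihomog s : multihomog (fun i => count (fun p => p.1 == i) s) (mon s).
Proof.
move=> w; rewrite -mcoeff_neq0 mcoeffU; case: (cmon s =P w) => [<- _ i|_]; last by rewrite eqxx.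
elim: s => [|p s IH] /=; first by rewrite big1 // => j _; rewrite onecmE.
under eq_bigr do rewrite mulcmE ucmE.
rewrite big_split /= IH; congr (_ + _)%N; case: p => i' j' /=.
rewrite (bigD1 j') //= xpair_eqE eqxx andbT big1 ?addn0 // => j jj'.
by rewrite xpair_eqE [j' == j]eq_sym (negPf jj') andbF.
Qed.

Variables (K : fieldType) (iota : {rmorphism F -> K}).
Implicit Types (x : mproj K r m).

Lemma peval_mon x s : peval iota x (mon s) = \prod_(p <- s) hcoord x p.1 p.2.
Proof.
rewrite /peval /mon mmapU /= rmorph1 mul1r.
elim: s => [|p s IH] /=.
  by rewrite big_nil big1 // => i _; rewrite big1 // => j _; rewrite onecmE.
rewrite big_cons -IH.
under eq_bigr => i _ do under eq_bigr => j _ do rewrite mulcmE ucmE exprD.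
under eq_bigr => i _ do rewrite big_split /=.
rewrite big_split /=; congr (_ * _).
rewrite (bigD1 p.1) //= (bigD1 p.2) //= -surjective_pairing eqxx expr1.
rewrite !big1 ?mulr1 // => i ip; last first.
  by case: eqP => // pE; rewrite pE eqxx in ip.
rewrite big1 // => j _; case: eqP => // pE.
by rewrite pE eqxx in ip.
Qed.

Lemma peval_mon_neq0 x s :
  peval iota x (mon s) <> 0 <-> forall p, p \in s -> hcoord x p.1 p.2 != 0.
Proof.
rewrite peval_mon; split=> [/eqP|H]; first by rewrite prodf_seq_neq0 => /allP.
by apply/eqP; rewrite prodf_seq_neq0; apply/allP => p /H.
Qed.

Lemma peval0 x : peval iota x 0 = 0.
Proof. exact: mmap0. Qed.

End Monomials.

(** All morphisms needed have this shape: where the coordinates listed in [h] are nonzero, each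
    component is a projection to a factor ([inl]) or a constant coordinate point ([inr]). *)
Lemma regular_simple (F : fieldType) (r s : nat)
    (PX : forall K : fieldType, {rmorphism F -> K} -> set (mproj K r 2))
    (PY : forall K : fieldType, {rmorphism F -> K} -> set (mproj K s 2))
    (f : point_map (PSubset PX) (PSubset PY)) :
  (forall (K : fieldType) (iota : {rmorphism F -> K}) (x : points (PSubset PX) iota),
     exists (h : seq ('I_r * 'I_2)) (t : 'I_s -> 'I_r + bool),
       (forall p, p \in h -> hcoord (val x) p.1 p.2 != 0) /\
       forall (K' : fieldType) (iota' : {rmorphism F -> K'})
              (y : points (PSubset PX) iota'),
         (forall p, p \in h -> hcoord (val y) p.1 p.2 != 0) ->
         forall i, val (f K' iota' y) i =
           match t i with inl k => val y k | inr b => ept K' b end) ->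
  regular f.
Proof.
move=> H K iota x i; have [h [t [hx hy]]] := H K iota x.
pose q (j : 'I_2) : mpol F r 2 := match t i with
  | inl k => mon F [:: (k, j)]
  | inr b => if j == bord b then mon F [::] else 0 end.
exists (mon F h), q; split.
- by eexists; exact: mon_multihomog.
- rewrite /q; case: (t i) => [k|b].
    by exists (fun i => (k == i) + 0)%N => j; exact: mon_multihomog.
  exists (fun=> 0%N) => j; case: ifP => _; first exact: mon_multihomog.
  by move=> w; rewrite msupp0.
- exact/peval_mon_neq0.
- move=> K' iota' y /peval_mon_neq0/hy/(_ i) ->; rewrite /q.
  case: (t i) => [k|b]; rewrite /=.
    rewrite {1}proj_vpick; congr <[_]>%VS; apply/rowP => j.
    by rewrite !mxE peval_mon big_seq1.
  congr <[_]>%VS; apply/rowP => j; rewrite !mxE eqxx /=.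
  by case: ifP => _; rewrite ?peval_mon ?big_nil ?peval0.
Qed.

Section Model.
Variable F : fieldType.
Implicit Types (S : set (nat -> bool)) (c : nat -> bool).

Definition model S c : seqset F 2 := fun K iota =>
  [set l | (exists z, l = line c z) \/ (exists2 u, S u & l = pt K u)].

Lemma level_modelP S c n (K : fieldType) (iota : {rmorphism F -> K}) x :
  points (seqset_level (model S c) n) iota x <->
  (exists z, x = trunc n (line c z)) \/ (exists2 u, S u & x = trunc n (pt K u)).
Proof.
split=> [[l [[z ->]|[u Su ->]] <-]|[[z ->]|[u Su ->]]].
- by left; exists z.
- by right; exists u.
- by exists (line c z) => //; left; exists z.
- by exists (pt K u) => //; right; exists u.
Qed.

(** The level is a finite union of sets given by linear forms X_(i,j) = 0; outside
    it, one form per component is nonzero, and the product of these forms is a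
    monomial vanishing on the level. *)
Lemma closed_level_model S c n : closed_variety (seqset_level (model S c) n).
Proof.
(* With all multihomogeneous polynomials vanishing on the level as equations, only points outside it
   need an argument. *)
exists [set p | is_multihomog p /\ forall (K : fieldType) (iota : {rmorphism F -> K}) x,
  points (seqset_level (model S c) n) iota x -> peval iota x p = 0].
split=> [p []//|K iota x]; split=> [xP p [_]|xV]; first exact.
apply: contrapT => /level_modelP nx.
have [ic [ic0 icP]] : exists i : 'I_n.+1, (0 < i)%N /\
    hcoord x i (bord (~~ bcons false c i)) != 0.
  apply: contra_notP nx => ni; left; exists (x ord0); apply/ffunP => i.
  rewrite ffunE /line; case iE: (i : nat) => [|k].
    by congr (x _); apply/val_inj.
  apply: ept_eq; apply/eqP; apply: contra_notT ni => H.
  by exists i; rewrite iE; split.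
have /choice[g gP] : forall w : {ffun 'I_n.+1 -> bool}, exists i : 'I_n.+1,
    (exists2 u, S u & forall i : 'I_n.+1, u i = w i) ->
    hcoord x i (bord (~~ w i)) != 0.
  move=> w; have [[u Su uw]|nw] := pselect (exists2 u, S u & forall i : 'I_n.+1, u i = w i);
    last by exists ord0.
  apply: contra_notP nx => ni; right; exists u => //; apply/ffunP => i.
  rewrite ffunE /pt uw; apply: ept_eq; apply/eqP; apply: contra_notT ni => H.
  by exists i.
pose W := [seq w : {ffun 'I_n.+1 -> bool} <- enum {ffun 'I_n.+1 -> bool} |
  `[< exists2 u, S u & forall i : 'I_n.+1, u i = w i >]].
pose h := (ic, bord (~~ bcons false c ic)) :: [seq (g w, bord (~~ w (g w))) | w <- W].
suff : peval iota x (mon F h) <> 0.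
  apply; apply: xV; split; first by eexists; exact: mon_multihomog.
  move=> K' iota' y /level_modelP[[z ->]|[u Su ->]]; apply: contrapT;
    move=> /peval_mon_neq0 H.
    have := H _ (mem_head _ _); rewrite hcoord_line //.
    by case: (bcons _ _ _).
  pose w := [ffun i : 'I_n.+1 => u i].
  have wW : w \in W.
    rewrite mem_filter mem_enum andbT; apply/asboolP; exists u => // i.
    by rewrite ffunE.
  have := H (g w, bord (~~ w (g w))).
  rewrite in_cons map_f // orbT => /(_ isT) /=.
  by rewrite hcoord_pt ffunE; case: (u _).
apply/peval_mon_neq0 => p; rewrite in_cons => /orP[/eqP -> //|/mapP[w]].
by rewrite mem_filter => /andP[/asboolP/gP gw _] ->.
Qed.

Lemma proalgebraic_model S c : proalgebraic (seqset_prosystem (model S c)).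
Proof.
move=> n; split; first exact: closed_level_model.
- apply: regular_simple => K iota x.
  exists [::], (fun i => inl (widen_ord (leqnSn n.+1) i)); split=> // K' iota' y _ i.
  by rewrite /= ffunE.
- move=> K iota [y yP]; have [l Zl ly] := set_mem yP.
  have xP : points (seqset_level (model S c) n.+1) iota (trunc n.+1 l) by exists l.
  exists (SigSub (mem_set xP)); apply/val_inj => /=.
  by rewrite drop_last_trunc.
Qed.

(** One position k + 1 where [l] differs from [c] excludes the line from all deeper levels; the
    truncations then come from [S], which is closed. *)
Lemma model_closed S c : seq_closed S ->
  forall (K : fieldType) (iota : {rmorphism F -> K}) (l : pseq K 2),
  (forall n, points (seqset_level (model S c) n) iota (trunc n l)) ->
  model S c iota l.
Proof.
move=> Sc K iota l lP.
have [lc|nlc] := pselect (forall k, l k.+1 = ept K (c k)).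
  by left; exists (l 0%N); apply/funext => -[|k] //=.
have [k nk] : exists k, l k.+1 <> ept K (c k).
  by apply: contrapT => nk; apply: nlc => k; apply: contra_notP nk; exists k.
have uP n : exists2 u, S u & trunc n l = trunc n (pt K u).
  have /level_modelP[[z]|[u Su]] := lP (maxn n k.+1).
    by move/trunc_agree/(_ k.+1); rewrite ltnS leq_maxr => /(_ isT).
  move/trunc_agree => E; exists u => //; apply/trunc_agree => i ni; apply: E.
  by rewrite (leq_trans ni) // ltnS leq_maxl.
have /choice[u lu] : forall i, exists b, l i = ept K b.
  by move=> i; have [u _ /trunc_agree/(_ i (ltnSn _)) ->] := uP i; exists (u i).
right; exists u; last by apply/funext.
apply: Sc => n; have [v Sv /trunc_agree E] := uP n; exists v => // i ni.
by apply: (@ept_inj K); rewrite -lu E // ltnW.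
Qed.

End Model.

Arguments model F S c [K] iota _ : rename.

Section SeqsetSystem.
Variables (F : fieldType) (m : nat) (Z : seqset F m).
Variables (K : fieldType) (iota : {rmorphism F -> K}).

Lemma transition_trunc i i' (le_ii' : (i <= i')%N)
    (x : points (level (seqset_prosystem Z) i') iota) (l : pseq K m) :
  val x = trunc i' l -> val (transition le_ii' x) = trunc i l.
Proof.
have add k (y : points (level (seqset_prosystem Z) (k + i)) iota) :
    val y = trunc (k + i) l -> val (transition_add y) = trunc i l.
  by elim: k y => [//|k IH] y yl /=; apply: IH; rewrite /= yl drop_last_trunc.
move=> xl; apply: add; case: _ / (esym (subnK le_ii')) => //.
Qed.

Lemma propoint_limit (a : propoint (seqset_prosystem Z) iota) :
  exists l, forall n, val (proj1_sig a n) = trunc n l.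
Proof.
case: a => a aP /=; pose v k : mproj K k.+1 m := val (a k).
have step k (i : 'I_k.+1) : v k i = v k.+1 (widen_ord (leqnSn k.+1) i).
  by rewrite /v -{1}(aP k) ffunE.
(* Factor i first appears as the last coordinate of level i, and the bonding maps preserve it. *)
exists (fun i => v i ord_max) => n; apply/ffunP => i; rewrite ffunE -/(v n).
elim: n i => [|n IH] i; first by rewrite (ord1 i); congr (v _ _); apply/val_inj.
have [->|ni] := eqVneq i ord_max; first by [].
have ltin : (i < n.+1)%N.
  by rewrite ltn_neqAle -ltnS ltn_ord andbT; apply: contra ni => /eqP ni; apply/eqP/val_inj.
transitivity (v n (Ordinal ltin)); last exact: IH.
by rewrite [RHS]step (_ : widen_ord _ _ = i) //; apply/val_inj.
Qed.

End SeqsetSystem.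

Section LineIso.
Variables (F : fieldType) (c : nat -> bool).
(** With the empty set in place of [S], the model reduces to the line. *)
Let L : seqset F 2 := model F set0 c.

Lemma lineP (K : fieldType) (iota : {rmorphism F -> K}) l :
  L iota l <-> exists z, l = line c z.
Proof. by split=> [[//|[u []]]|]; left. Qed.

Definition line_fst j : point_map (level (seqset_prosystem L) j) (proj_line F) :=
  fun K iota x => SigSub (mem_set (I : [set: mproj K 1 2] [ffun=> val x ord0])).

Lemma line_mem j (K : fieldType) (iota : {rmorphism F -> K}) z :
  points (seqset_level L j) iota (trunc j (line c z)).
Proof. by exists (line c z) => //; apply/lineP; exists z. Qed.

Definition line_pt j : point_map (proj_line F) (level (seqset_prosystem L) j) :=
  fun K iota x => SigSub (mem_set (line_mem j iota (val x ord0))).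

Lemma const_transition i i' (le_ii' : (i <= i')%N) (K : fieldType)
    (iota : {rmorphism F -> K}) (x : points (proj_line F) iota) :
  @transition F (const_proj_line F) K iota i i' le_ii' x = x.
Proof.
have add k (y : points (proj_line F) iota) :
  @transition_add F (const_proj_line F) K iota i k y = y by elim: k y.
by rewrite /transition add; case: _ / (esym (subnK le_ii')).
Qed.

Lemma pro_iso_line : pro_iso (seqset_prosystem L) (const_proj_line F).
Proof.
split; first exact: proalgebraic_model.
  move=> n; split; first by exists set0; split=> // K iota x; split.
    apply: regular_simple => K iota x.
    by exists [::], inl; split.
  by move=> K iota y; exists y.
have regM j (_ : (0 <= j)%N) : regular (@line_fst j).
  apply: regular_simple => K iota x; exists [::], (fun=> inl ord0); split=> // K' iota' y _ i.
  by rewrite ffunE.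
have regN j (_ : (0 <= j)%N) : regular (@line_pt j).
  apply: regular_simple => K iota x.
  exists [::], (fun i : 'I_j.+1 => if (i : nat) is k.+1 then inr (c k) else inl ord0).
  split=> // K' iota' y _ i; rewrite /= ffunE /line.
  by case: (i : nat).
have mono : forall j j' : nat, (0 <= j)%N -> (j <= j')%N -> (id j <= id j')%N by [].
have trM j j' (hj : (0 <= j)%N) (hj' : (0 <= j')%N) (le_jj' : (j <= j')%N)
    (K : fieldType) (iota : {rmorphism F -> K})
    (x : points (level (seqset_prosystem L) j') iota) :
  @line_fst j K iota (transition (mono j j' hj le_jj') x)
  = @transition F (const_proj_line F) K iota j j' le_jj' (@line_fst j' K iota x).
  rewrite const_transition; apply/val_inj/ffunP => i; rewrite !ffunE.
  have [l _ /esym xl] := set_mem (valP x).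
  by rewrite (transition_trunc _ xl) xl !ffunE.
have trN j j' (hj : (0 <= j)%N) (hj' : (0 <= j')%N) (le_jj' : (j <= j')%N)
    (K : fieldType) (iota : {rmorphism F -> K})
    (x : points (level (const_proj_line F) j') iota) :
  @line_pt j K iota (transition (mono j j' hj le_jj') x)
  = transition le_jj' (@line_pt j' K iota x).
  rewrite [transition (mono _ _ _ _) _]const_transition; apply/val_inj.
  by rewrite (@transition_trunc _ _ _ _ _ _ _ _ _ (line c (val x ord0))).
exists (@ProMorphism F (seqset_prosystem L) (const_proj_line F) 0 id mono
  (fun j _ => @line_fst j) regM trM).
exists (@ProMorphism F (const_proj_line F) (seqset_prosystem L) 0 id mono
  (fun j _ => @line_pt j) regN trN).
move=> K iota a b; split=> H j hj; have {}H := H j hj; apply/val_inj.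
  have [l /lineP[z ->] /esym al] := set_mem (valP (proj1_sig a j)).
  by rewrite -H /= al !ffunE.
by rewrite -H; apply/ffunP => i; rewrite !ffunE (ord1 i).
Qed.

End LineIso.

(** * Isomorphisms *)

Section ModelMap.
Variables (F : fieldType) (S S' : set (nat -> bool)) (c c' : nat -> bool).
Variable f : (nat -> bool) -> nat -> bool.
Hypotheses (S_bcons : forall b, S (bcons b c)) (fS : forall u, S u -> S' (f u)).
Hypotheses (f_bcons : forall b, f (bcons b c) = bcons b c') (f_unif : unif_cont S f).

Let Z := model F S c.
Let Z' := model F S' c'.

(** The map f glued with the identity of the line. *)
Definition model_rel (K : fieldType) (l l' : pseq K 2) :=
  (exists z, l = line c z /\ l' = line c' z) \/
  (exists u, [/\ S u, l = pt K u & l' = pt K (f u)]).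

Lemma model_rel_total (K : fieldType) (iota : {rmorphism F -> K}) l :
  Z iota l -> exists2 l', Z' iota l' & model_rel l l'.
Proof.
move=> [[z ->]|[u Su ->]].
  by exists (line c' z); left; exists z.
exists (pt K (f u)); right; [exists (f u) => //; exact: fS | by exists u].
Qed.

(** Partial sums of the moduli of continuity are still moduli and are monotone, as an index map has
    to be. *)
Lemma model_modulus : exists g : nat -> nat,
  (forall j j', (j <= j')%N -> (g j <= g j')%N) /\
  (forall j u v, S u -> S v -> agree (g j).+1 u v -> agree j.+1 (f u) (f v)).
Proof.
have /choice[g gP] := fun j => f_unif j.+1.
exists (fun j => \sum_(i < j.+1) g i)%N; split.
  apply: (@homo_leq nat (fun j => \sum_(i < j.+1) g i)%N leq) => [//|? ? ?|j].
    exact: leq_trans.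
  by rewrite [leqRHS]big_ord_recr leq_addr.
move=> j u v Su Sv uv; apply: gP => //; apply: agree_le uv.
by rewrite big_ord_recr /= leqW // leq_addl.
Qed.

Variable g : nat -> nat.
Hypothesis g_mono : forall j j', (0 <= j)%N -> (j <= j')%N -> (g j <= g j')%N.
Hypothesis g_modulus :
  forall j u v, S u -> S v -> agree (g j).+1 u v -> agree j.+1 (f u) (f v).

(** Gluing is consistent on levels: if a point of the line and one of [S] have the same truncation,
    the former starts with a coordinate point, so it is some [bc], and [f] sends [bc] to [bc']. *)
Lemma model_rel_trunc (K : fieldType) j (l1 l2 l1' l2' : pseq K 2) :
  model_rel l1 l1' -> model_rel l2 l2' ->
  trunc (g j) l1 = trunc (g j) l2 -> trunc j l1' = trunc j l2'.
Proof.
have line_pt z u : S u -> trunc (g j) (line c z) = trunc (g j) (pt K u) ->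
    trunc j (line c' z) = trunc j (pt K (f u)).
  move=> Su E; have z0 : z = ept K (u 0%N) by have /trunc_agree/(_ 0%N isT) := E.
  move: E; rewrite z0 !line_ept => /trunc_pt E; apply/trunc_pt.
  by rewrite -f_bcons; apply: g_modulus.
move=> [[z [-> ->]]|[u [Su -> ->]]] [[z' [-> ->]]|[v [Sv -> ->]]].
- by move/trunc_agree/(_ 0%N isT) => /= ->.
- exact: line_pt.
- by move/esym/line_pt => /(_ Su) ->.
- by move/trunc_pt/g_modulus => /(_ Su Sv) /trunc_pt.
Qed.

Lemma model_map_ex j (K : fieldType) (iota : {rmorphism F -> K})
    (x : points (level (seqset_prosystem Z) (g j)) iota) :
  exists y : points (level (seqset_prosystem Z') j) iota,
  forall l l', model_rel l l' -> val x = trunc (g j) l -> val y = trunc j l'.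
Proof.
have [l Zl xl] := set_mem (valP x); have [l' Zl' ll'] := model_rel_total Zl.
have yP : points (level (seqset_prosystem Z') j) iota (trunc j l') by exists l'.
exists (SigSub (mem_set yP)) => l1 l1' R1 x1 /=.
by apply: model_rel_trunc ll' R1 _; rewrite xl.
Qed.

Definition model_map j :
    point_map (level (seqset_prosystem Z) (g j)) (level (seqset_prosystem Z') j) :=
  fun K iota x => projT1 (cid (model_map_ex x)).

Lemma model_mapP j (K : fieldType) (iota : {rmorphism F -> K})
    (x : points (level (seqset_prosystem Z) (g j)) iota) l l' :
  model_rel l l' -> val x = trunc (g j) l -> val (model_map x) = trunc j l'.
Proof. rewrite /model_map; case: cid => y /= H; exact: H. Qed.

Lemma model_map_regular j : regular (@model_map j).
Proof.
apply: regular_simple => K iota x.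
have [[z xz]|nx] := pselect (exists z, val x = trunc (g j) (line c z)).
  (* Nonvanishing at the letters of [c] in positive positions cuts out exactly the line in this
     level. The filler [false] at position 0 is filtered away. *)
  pose h := [seq (i, bord (bcons false c i)) | i : 'I_(g j).+1 <- enum 'I_(g j).+1 & (0 < i)%N].
  exists h, (fun i : 'I_j.+1 => if (i : nat) is k.+1 then inr (c' k) else inl ord0).
  have hP K' (y : mproj K' (g j).+1 2) :
      (forall p, p \in h -> hcoord y p.1 p.2 != 0) <->
      forall i : 'I_(g j).+1, (0 < i)%N -> hcoord y i (bord (bcons false c i)) != 0.
    split=> [H i i0|H p /mapP[i]]; last by rewrite mem_filter => /andP[/H yi _] ->.
    by apply: (H (i, _)); rewrite map_f // mem_filter i0 mem_enum.
  split=> [|K' iota' y /hP yh i].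
    by apply/hP => i i0; rewrite xz hcoord_line.
  have yE : val y = trunc (g j) (line c (val y ord0)).
    have /level_modelP[[w yw]|[u Su yu]] := set_mem (valP y).
      by rewrite {1}yw yw ffunE.
    have -> : val y ord0 = ept K' (u 0%N) by rewrite yu ffunE.
    rewrite line_ept yu; apply/trunc_pt => -[//|k] kg /=; apply/eqP.
    have := yh (Ordinal kg) isT.
    by rewrite yu hcoord_pt.
  rewrite (model_mapP (l' := line c' (val y ord0)) _ yE); last by left; eexists.
  by rewrite ffunE /line; case: (i : nat).
have /level_modelP[[z xz]|[u Su xu]] := set_mem (valP x); first by case: nx; exists z.
(* Off the line this monomial isolates one point, so the map is locally constant: a line point in
   the neighbourhood would force [u] to follow [c] after position 0, putting [x] on the line. *)
pose h := [seq (i, bord (u i)) | i : 'I_(g j).+1 <- enum 'I_(g j).+1].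
exists h, (fun i : 'I_j.+1 => inr (f u i)).
have hP K' (y : mproj K' (g j).+1 2) :
    (forall p, p \in h -> hcoord y p.1 p.2 != 0) <->
    forall i : 'I_(g j).+1, hcoord y i (bord (u i)) != 0.
  split=> [H i|H p /mapP[i _ ->] //].
  by apply: (H (i, _)); rewrite map_f // mem_enum.
split=> [|K' iota' y /hP yh i].
  by apply/hP => i; rewrite xu hcoord_pt.
have yE : val y = trunc (g j) (pt K' u).
  have /level_modelP[[w yw]|[v Sv yv]] := set_mem (valP y); last first.
    rewrite yv; apply/trunc_pt => k kg; apply/eqP.
    by have := yh (Ordinal kg); rewrite yv hcoord_pt.
  case: nx; exists (ept K (u 0%N)); rewrite line_ept xu; apply/trunc_pt => -[//|k] kg.
  by have := yh (Ordinal kg); rewrite yw hcoord_line // => /eqP /= ->.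
rewrite (model_mapP (l' := pt K' (f u)) _ yE); last by right; exists u.
by rewrite ffunE.
Qed.

Lemma model_map_transition j j' (hj : (0 <= j)%N) (hj' : (0 <= j')%N)
    (le_jj' : (j <= j')%N) (K : fieldType) (iota : {rmorphism F -> K})
    (x : points (level (seqset_prosystem Z) (g j')) iota) :
  model_map (transition (g_mono hj le_jj') x) = transition le_jj' (model_map x).
Proof.
have [l Zl /esym xl] := set_mem (valP x); have [l' Zl' ll'] := model_rel_total Zl.
apply/val_inj.
rewrite (transition_trunc le_jj' (model_mapP ll' xl)).
by rewrite (model_mapP ll' (transition_trunc _ xl)).
Qed.

Definition model_promorphism : promorphism (seqset_prosystem Z) (seqset_prosystem Z') :=
  @ProMorphism F (seqset_prosystem Z) (seqset_prosystem Z') 0 g g_mono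
    (fun j _ => @model_map j) (fun j _ => @model_map_regular j) model_map_transition.

Lemma model_promorphismP (K : fieldType) (iota : {rmorphism F -> K})
    (a : propoint (seqset_prosystem Z) iota) (b : propoint (seqset_prosystem Z') iota)
    (l l' : pseq K 2) : Z iota l ->
  (forall n, val (proj1_sig a n) = trunc n l) ->
  (forall n, val (proj1_sig b n) = trunc n l') ->
  induced model_promorphism a b <-> model_rel l l'.
Proof.
move=> Zl al bl'; split=> [H|ll' j hj]; last first.
  by apply/val_inj; rewrite bl' /=; apply: (model_mapP ll').
have [l1 _ ll1] := model_rel_total Zl; suff -> : l' = l1 by [].
apply: trunc_eq => n; rewrite -bl' -(H n (leq0n n)) /=.
exact: (model_mapP ll1).
Qed.

End ModelMap.

Lemma pro_iso_model (F : fieldType) S c S' c' :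
  pointed_cantor S c -> pointed_cantor S' c' ->
  pro_iso (seqset_prosystem (model F S c)) (seqset_prosystem (model F S' c')).
Proof.
move=> HS HS'; split; [exact: proalgebraic_model|exact: proalgebraic_model|].
have [f [f' [fK f'K fb fu f'u]]] := cantor_pair_homeo HS HS'.
have [g [gm gf]] := model_modulus fu; have [g' [g'm g'f]] := model_modulus f'u.
have Sb := pcantor_bcons HS; have Sb' := pcantor_bcons HS'.
have fS u : S u -> S' (f u) by case/fK.
have f'S u : S' u -> S (f' u) by case/f'K.
have fb1 b : f (bcons b c) = bcons b c' by case: (fb b).
have fb2 b : f' (bcons b c') = bcons b c by case: (fb b).
exists (model_promorphism F Sb fS fb1 (fun j j' _ => gm j j') gf).
exists (model_promorphism F Sb' f'S fb2 (fun j j' _ => g'm j j') g'f).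
move=> K iota a b.
have [l al] := propoint_limit a; have [l' bl'] := propoint_limit b.
have Zl : model F S c iota l.
  apply: (model_closed (pcantor_closed HS)) => n.
  by rewrite -al; exact: set_mem (valP _).
have Zl' : model F S' c' iota l'.
  apply: (model_closed (pcantor_closed HS')) => n.
  by rewrite -bl'; exact: set_mem (valP _).
rewrite (model_promorphismP _ _ _ _ _ Zl al bl').
rewrite (model_promorphismP _ _ _ _ _ Zl' bl' al).
split=> -[[z [-> ->]]|[u [Su -> ->]]]; try by left; exists z.
  by right; exists (f u); split; [exact: fS| |have [_ ->] := fK _ Su].
by right; exists (f' u); split; [exact: f'S| |have [_ ->] := f'K _ Su].
Qed.

(** * Topology *)

(** In both continuity proofs each coordinate or truncation is locally constant, so Zariski
    neighbourhoods in the target need no description. *)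
Lemma cvg_initial_cst (S : choiceType) (T : topologicalType) (w : S -> T)
    (G : set_system S) (s : S) : Filter G ->
  G [set t | w t = w s] -> G --> (s : initial_topology w).
Proof.
move=> FG Gs A; rewrite nbhsE => -[B [[D oD <-] Ds] sBA].
by apply: filterS Gs => t wt; apply: sBA; rewrite /= wt.
Qed.

Lemma nbhs_agree n (x : cantor_space) : nbhs x [set y : cantor_space | agree n x y].
Proof.
elim: n => [|n IH]; first by apply: filterS filterT => y _.
have xn : nbhs x [set y : cantor_space | y n = x n].
  exact: (@proj_continuous nat (fun=> bool) n x _ (discrete_set1 (x n))).
by apply: filterS2 IH xn => y xy yx; apply: agreeS.
Qed.

Section CantorPoints.
Variables (F : fieldType) (S : set (nat -> bool)).
Let C : set (pseq F 2) := [set pt F u | u in S].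

Lemma trunc_continuous n : continuous (@trunc F 2 n).
Proof.
move=> l; have /cvg_sup/(_ n) cl : nbhs l --> l by exact: cvg_id.
move=> A Al; apply: cl; exact: (@initial_continuous _ _ (@trunc F 2 n) l A).
Qed.

Lemma mon_open r m (s : seq ('I_r * 'I_m)) :
  open [set x : mproj F r m | peval (idF F) x (mon F s) <> 0].
Proof.
set A := [set x | _].
have sA : @zariski_basic F r m A.
  by exists (mon F s) => //; eexists; exact: mon_multihomog.
exists [set A]; last by rewrite bigcup_set1.
move=> _ ->; exists [fset A]%fset; first by move=> B; rewrite in_fset1 => /eqP ->; apply/mem_set.
by rewrite set_fset1 bigcap_set1.
Qed.

Definition cseq (x : C) : nat -> bool := s2val (cid2 (set_mem (valP x))).

Lemma cseqP (x : C) : S (cseq x) /\ pt F (cseq x) = val x.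
Proof. by rewrite /cseq; case: cid2. Qed.

(** Cylinders are Zariski neighbourhoods: on [C], the product of the coordinates selected by the
    first n + 1 letters of [x] is nonzero exactly where these letters agree. *)
Lemma nbhs_cseq n (x : C) : nbhs x [set y : C | agree n (cseq x) (cseq y)].
Proof.
pose h : seq ('I_n.+1 * 'I_2) :=
  [seq (i, bord (cseq x i)) | i : 'I_n.+1 <- enum 'I_n.+1].
have H (y : C) : peval (idF F) (trunc n (val y)) (mon F h) <> 0 <-> agree n.+1 (cseq x) (cseq y).
  have [_ <-] := cseqP y; rewrite peval_mon_neq0; split=> [yh i ni|xy p /mapP[i _ ->]].
    have := yh (Ordinal ni, _) (map_f _ (mem_enum _ _)).
    by rewrite hcoord_pt => /eqP.
  by rewrite hcoord_pt -xy.
have cx : {for x, continuous (@trunc F 2 n \o (val : C -> pseq F 2))}.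
  apply: continuous_comp; [exact: initial_continuous | exact: trunc_continuous].
have : nbhs x [set y : C | peval (idF F) (trunc n (val y)) (mon F h) <> 0].
  apply: (cx [set y : mproj F n.+1 2 | peval (idF F) y (mon F h) <> 0]).
  apply: open_nbhs_nbhs; split; first exact: mon_open.
  by apply/H.
by apply: filterS => y /H; apply: agree_le.
Qed.

Lemma homeomorphic_cantor (f g : (nat -> bool) -> nat -> bool) :
  (forall u, S u -> g (f u) = u) -> (forall x, S (g x) /\ f (g x) = x) ->
  unif_cont S f -> unif_cont setT g -> homeomorphic C cantor_space.
Proof.
move=> fK gK fu gu.
have gC (x : cantor_space) : C (pt F (g x)) by exists (g x) => //; case: (gK x).
pose G (x : cantor_space) : C := SigSub (mem_set (gC x)).
have cseqG x : cseq (G x) = g x by have [_ /pt_inj] := cseqP (G x).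
exists (fun x => f (cseq x) : cantor_space), G; split.
- move=> x; apply/val_inj => /=; have [Sx xE] := cseqP x.
  by rewrite fK.
- by move=> x; rewrite cseqG; case: (gK x).
- move=> x; apply/cvg_sup => [|i]; first exact: (fmap_filter _ (nbhs_filter x)).
  apply: cvg_initial_cst; first exact: (fmap_filter _ (nbhs_filter x)).
  have [N HN] := fu i.+1; apply: (filterS _ (nbhs_cseq N x)) => y xy /=.
  have [[Sx _] [Sy _]] := (cseqP x, cseqP y).
  by apply/esym/(HN _ _ Sx Sy xy).
- apply: continuous_comp_initial => x; apply/cvg_sup => n; apply: cvg_initial_cst.
  have [N HN] := gu n.+1; apply: (filterS _ (nbhs_agree N x)) => y xy /=.
  by apply/esym/trunc_pt/HN.
Qed.

End CantorPoints.

(** * Monomial P^1 *)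

Lemma monomial_P1_sturmian (F : fieldType) (A : monomial_algebra F)
    (o : bool -> 'I_(ngen A)) : monomial_P1 A -> bijective o ->
  sturmian (fun s => wordval (map o s) != 0).
Proof.
move=> [prA hA] o_bij; split=> [u v w|u v u0 v0|n].
- by rewrite !map_cat !wordval_cat; apply: contra_neq => ->; rewrite mul0r mulr0.
- have [w w0] := prime_wordval prA u0 v0; have [o' _ o'K] := o_bij.
  by exists (map o' w); rewrite !map_cat -map_comp (eq_map o'K) map_id.
set W := [pred t : n.-tuple bool | wordval (map o t) != 0].
have cW : #|W| = n.+1.
  exact: has_dim_uniq (homog_comp_dim n o_bij) (hilbert_series_P1_dim hA n).
exists (map val (enum W)); split=> [||s].
- by rewrite map_inj_uniq ?enum_uniq //; exact: val_inj.
- by rewrite size_map -cardE.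
apply/mapP/andP => [[t + ->]|[s0 sn]].
  by rewrite mem_enum inE size_tuple eqxx.
by exists (Tuple sn) => //; rewrite mem_enum inE.
Qed.

(** * From conditions on words to the model *)

Section WordsModel.
Variables (F : fieldType) (X : seqset F 2) (V : pred (seq 'I_2)).
Let Vb s := V (map bord s).
Hypothesis V_sturmian : sturmian Vb.
Hypothesis XP : forall (K : fieldType) (iota : {rmorphism F -> K}) (l : pseq K 2),
  X iota l <-> forall i s, wcoef (fun i => pcoord (l i)) i s != 0 -> V s.

Section Pattern.
Variables (K : fieldType) (iota : {rmorphism F -> K}) (l : pseq K 2).
Let nz i b := pcoord (l i) (bord b) != 0.

Lemma wcoef_bord i s : wcoef (fun i => pcoord (l i)) i (map bord s) != 0 <->
  forall k, (k < size s)%N -> nz (i + k) (nth false s k).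
Proof.
elim: s i => [|b s IH] i /=; first by split=> // _; exact: oner_neq0.
rewrite mulf_eq0 negb_or; split=> [/andP[ib /IH sP] [|k] //= ks|sP].
- by rewrite addn0.
- by rewrite addnS -addSn; exact: sP.
apply/andP; split; first by have := sP 0%N isT; rewrite addn0.
by apply/IH => k ks; rewrite addSnnS; exact: (sP k.+1).
Qed.

Lemma pattern_ex : exists v, forall i, nz i (v i).
Proof.
suff /choice[v vP] : forall i, exists b, nz i b by exists v.
move=> i; have [j lj] := pcoord_neq0 (l i).
by have [b jb] := bord_surj j; exists b; rewrite /nz -jb.
Qed.

Lemma pattern_limit :
  X iota l <-> forall u, (forall i, nz i (u i)) -> shift_space Vb u.
Proof.
split=> [/XP lX u uP n|lX].
  apply: (lX 0%N); apply/wcoef_bord => k; rewrite size_mkseq => kn.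
  by rewrite nth_mkseq.
apply/XP => i s; have [v vP] := pattern_ex.
have [s' ->] : exists s', s = map bord s'.
  elim: s => [|j s [s' ->]]; first by exists [::].
  by have [b ->] := bord_surj j; exists (b :: s').
move=> /wcoef_bord sP.
(* The finite word is pasted at position i into a full pattern [v] of nonzero coordinates. *)
pose u k := if (k < i)%N then v k else
  if (k - i < size s')%N then nth false s' (k - i) else v k.
have Su : shift_space Vb u.
  apply: lX => k; rewrite /u; case: ltnP => // ik; case: ltnP => // ks.
  by rewrite -[X in nz X](subnKC ik); apply: sP.
suff -> : s' = mkseq (fun k => u (i + k)%N) (size s').
  by apply: (sturm_suffix V_sturmian (s := mkseq u i)); rewrite -mkseqD; apply: Su.
apply: (@eq_from_nth _ false) => [|k ks]; first by rewrite size_mkseq.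
by rewrite nth_mkseq // /u ltnNge leq_addr addKn ks.
Qed.

End Pattern.

Lemma words_model : exists S c, pointed_cantor S c /\ X = model F S c.
Proof.
have [c cL] := left_special_word V_sturmian.
exists (shift_space Vb), c; split.
  split; first exact: shift_space_closed.
    by move=> u n; exact: shift_space_perfect.
  exact: shift_space_bcons.
apply: functional_extensionality_dep => K; apply: functional_extensionality_dep => iota.
apply/seteqP; split=> l.
  move=> /pattern_limit lX; have [v vP] := pattern_ex l.
  pose nz i b := pcoord (l i) (bord b) != 0.
  have [single|star] := pselect (forall i, ~~ nz i (~~ v i)).
    right; exists v; first exact: lX.
    by apply/funext => i; apply: ept_eq; apply/eqP; move: (single i); rewrite negbK.
  have [i ni] : exists i, nz i (~~ v i).
    by apply: contra_notP star => ni i; apply: contra_notN ni => ni; exists i.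
  have nzi b : nz i b by have := vP i; case: (v i) b ni => [] [].
  have lXi w : (forall k, k != i -> nz k (w k)) -> shift_space Vb w.
    by move=> wP; apply: lX => k; have [->|/wP//] := eqVneq k i; exact: nzi.
  (* Both letters are possible at i, so whatever is read after i can be preceded by either and must
     be [c]. *)
  have tail w : (forall k, k != i -> nz k (w k)) -> (fun k => w (i.+1 + k)%N) = c.
    move=> wP; apply: (bcons_shift_space V_sturmian cL) => b.
    pose w' k := if k == i then b else w k.
    have Sw' : shift_space Vb w'.
      by apply: lXi => k ki; rewrite /w' (negPf ki); exact: wP.
    have := shift_space_shift V_sturmian i Sw'; congr (shift_space Vb _).
    apply/funext => -[|k]; rewrite /w' /= ?addn0 ?eqxx //.
    by rewrite -{2}[i]addn0 eqn_add2l /= addSnnS.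
  have i0 : i = 0%N.
    case: i ni nzi lXi tail => // i ni nzi lXi tail.
    (* Repeating at the doubly nonzero position i + 1 the letter just before it produces [a a c]. *)
    pose w' k := if k == i.+1 then v i else v k.
    have Sw' : shift_space Vb w'.
      by apply: lXi => k ki; rewrite /w' (negPf ki); exact: vP.
    case: (@shift_space_double _ V_sturmian c cL (v i)).
    have := shift_space_shift V_sturmian i Sw'; congr (shift_space Vb _).
    rewrite -(tail v); last by move=> k _; exact: vP.
    apply/funext => -[|[|k]]; rewrite /w' /= ?addn0 ?addn1 ?eqxx //.
      by rewrite ltn_eqF.
    by rewrite gtn_eqF; [congr (v _)|]; lia.
  subst i; left; exists (l 0%N); apply/funext => -[|k] //=.
  apply: ept_eq; apply/eqP; apply: contraT => nk.
  (* A nonzero coordinate at the letter [~~ c k] would allow this pattern, whose tail differs from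
     [c] at k. *)
  pose w j := if j == k.+1 then ~~ c k else v j.
  have wP j : j != 0%N -> nz j (w j).
    by move=> _; rewrite /w; case: eqP => [->//|_]; exact: vP.
  have /(congr1 (@^~ k)) := tail w wP.
  by rewrite add1n /w eqxx; case: (c k).
move=> [[z ->]|[u Su ->]]; apply/pattern_limit => u' uP.
  suff -> : u' = bcons (u' 0%N) c by exact: shift_space_bcons.
  by apply/funext => -[//|k] /=; have := uP k.+1; rewrite pcoord_ept => /eqP.
suff -> : u' = u by [].
by apply/funext => i; have := uP i; rewrite pcoord_ept => /eqP.
Qed.

End WordsModel.

Section ModelGeometry.
Variables (F : fieldType) (S : set (nat -> bool)) (c : nat -> bool).
Hypothesis HS : pointed_cantor S c.
Let L := model F set0 c.
Let C : set (pseq F 2) := [set pt F u | u in S].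

Lemma model_homeomorphic : homeomorphic C cantor_space.
Proof.
have [f [g [fK gK _ fu gu]]] := cantor_chart HS.
exact: homeomorphic_cantor fK gK fu gu.
Qed.

Lemma model_setU : model F S c (idF F) = L (idF F) `|` C.
Proof.
apply/seteqP; split=> l.
  by move=> [lz|[u Su ->]]; [left; left | right; exists u].
by move=> [[lz|[u []]]|[u Su <-]]; [left | right; exists u].
Qed.

Lemma model_card_setI : (L (idF F) `&` C #= `I_2)%card.
Proof.
pose f n := pt F (bcons (n == 0%N) c).
have -> : L (idF F) `&` C = f @` `I_2.
  apply/seteqP; split=> l.
    move=> [[[z ->]|[u []]] [u Su E]].
    have z0 : z = ept F (u 0%N) by have /(congr1 (@^~ 0%N)) := E.
    rewrite z0 line_ept; case: (u 0%N); first by exists 0%N.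
    by exists 1%N.
  move=> [n _ <-]; split; first by left; exists (ept F (n == 0%N)); rewrite line_ept.
  by exists (bcons (n == 0%N) c) => //; exact: pcantor_bcons.
apply: inj_card_eq => n k; rewrite !inE /= => n2 k2 /pt_inj/(congr1 (@^~ 0%N)) /=.
by case: n k n2 k2 => [|[|n]] [|[|k]].
Qed.

End ModelGeometry.

(** The number of coordinates is a variable [m] here: the equality of [ngen A] with 2 is only
    proved, and [m], unlike [ngen A], can be replaced by 2 throughout. *)
Definition sturmian_seqset (F : fieldType) (m : nat) (X : seqset F m) :=
  m = 2%N /\ exists V : pred (seq 'I_m),
  (forall o : bool -> 'I_m, bijective o -> sturmian (fun s => V (map o s))) /\
  (forall (K : fieldType) (iota : {rmorphism F -> K}) (l : pseq K m),
    X K iota l <-> forall i s, wcoef (fun i => pcoord (l i)) i s != 0 -> V s).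

Lemma limP_sturmian (F : fieldType) (A : monomial_algebra F) :
  monomial_P1 A -> sturmian_seqset (limP A).
Proof.
move=> AP; split; first by apply: ngen_P1; case: AP.
exists (fun s => wordval s != 0); split=> [o|K iota l]; last exact: limPE.
exact: monomial_P1_sturmian.
Qed.

Lemma bord_bij : bijective bord.
Proof. by exists (fun j : 'I_2 => j == ord_max) => [[]|[[|[|]] // j2]] //; apply/val_inj. Qed.

Lemma sturmian_seqset_model (F : fieldType) (X : seqset F 2) : sturmian_seqset X ->
  exists S c, pointed_cantor S c /\ X = model F S c.
Proof.
by move=> [_ [V [VS VX]]]; apply: words_model (VS _ bord_bij) VX.
Qed.

Lemma sturmian_seqset_geometry (F : fieldType) (m : nat) (X : seqset F m) :
  sturmian_seqset X ->
  proalgebraic (seqset_prosystem X) /\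
  exists (L : seqset F m) (C : set (pseq F m)),
    [/\ [/\ forall (K : fieldType) (iota : {rmorphism F -> K}), L K iota `<=` X K iota,
            forall (K : fieldType) (iota : {rmorphism F -> K}) (l : pseq K m),
              (forall n, points (seqset_level L n) iota (trunc n l)) -> L K iota l &
            pro_iso (seqset_prosystem L) (const_proj_line F)],
        homeomorphic C cantor_space,
        X F (idF F) = L F (idF F) `|` C &
        (L F (idF F) `&` C #= `I_2)%card].
Proof.
move=> XS; have m2 : m = 2%N by case: XS.
subst m; have [S [c [HS ->]]] := sturmian_seqset_model XS.
split; first exact: proalgebraic_model.
exists (model F set0 c), [set pt F u | u in S]; split.
- split; [by move=> K iota l [|[u []]]; left| |exact: pro_iso_line].
  by apply: model_closed => u /(_ 0%N)[].
- exact: model_homeomorphic HS.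
- exact: model_setU.
- exact: model_card_setI HS.
Qed.

Lemma sturmian_seqset_iso (F : fieldType) (m m' : nat) (X : seqset F m)
    (X' : seqset F m') : sturmian_seqset X -> sturmian_seqset X' ->
  pro_iso (seqset_prosystem X) (seqset_prosystem X').
Proof.
move=> XS X'S; have m2 : m = 2%N by case: XS.
have m'2 : m' = 2%N by case: X'S.
subst m m'; have [S [c [HS ->]]] := sturmian_seqset_model XS.
have [S' [c' [HS' ->]]] := sturmian_seqset_model X'S.
exact: pro_iso_model.
Qed.

Theorem theorem10p4 (F : fieldType) :
  (forall A : monomial_algebra F, monomial_P1 A ->
     proalgebraic (PA A) /\
     exists (L : seqset F (ngen A)) (C : set (pseq F (ngen A))),
       [/\ projective_line L,
           homeomorphic C cantor_space,
           limP A (idF F) = L F (idF F) `|` C &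
           (L F (idF F) `&` C #= `I_2)%card]) /\
  (forall A B : monomial_algebra F, monomial_P1 A -> monomial_P1 B ->
     pro_iso (PA A) (PA B)).
Proof.
split=> [A /limP_sturmian|A B /limP_sturmian AS /limP_sturmian].
  exact: sturmian_seqset_geometry.
exact: sturmian_seqset_iso.
Qed.
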